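(* Let $p$ be an odd prime, let $E$ be a complex elliptic curve and let $\tau\in E$ be a point of order $2$. Then the $p$-dimensional Sklyanin algebra $Q_{p,1}(E,\tau)$ is a graded Clifford algebra (i.e. it is isomorphic, as a graded algebra, to some graded Clifford algebra $A(M)$).
   Context: Sklyanin algebras. Let $E=\mathbb C/\Gamma$ with $\Gamma=\mathbb Z+\mathbb Z\eta$, $\mathrm{Im}\,\eta>0$, and $n\ge3$. Put $\theta(z)=\sum_{k\in\mathbb Z}(-1)^k e^{2\pi i(kz+\frac{k(k-1)}2\eta)}$ and, for $\alpha\in\mathbb Z$, $$\theta_\alpha(z)=e^{2\pi i\left(\alpha z+\frac{\alpha(\alpha-n)}{2n}\eta+\frac{\alpha}{2n}\right)}\prod_{m=0}^{n-1}\theta\!\left(z+\tfrac mn+\tfrac{\alpha}{n}\eta\right).$$ Then $\theta_{\alpha+n}=\theta_\alpha$, so $\theta_0,\dots,\theta_{n-1}$ are indexed by $\mathbb Z_n=\mathbb Z/n\mathbb Z$ (theta functions of order $n$). For $\tau\in E$ which is not an $n$-torsion point, $Q_{n,1}(E,\tau)$ is the graded $\mathbb C$-algebra generated by $x_i$, $i\in\mathbb Z_n$, in degree 1, with relations $$\sum_{r\in\mathbb Z_n}\frac{\theta_{j-i}(0)}{\theta_{j-i-r}(-\tau)\,\theta_r(\tau)}\,x_{j-r}x_{i+r}=0\qquad(i,j\in\mathbb Z_n,\ i\ne j).$$ Graded Clifford algebras. Let $R=\mathbb C[y_1,\dots,y_n]$ with $\deg y_i=2$ and let $M$ be a symmetric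 $n\times n$ matrix with entries in $R_2$ (the degree-2 part, i.e. linear forms in the $y_i$) with $\det M\ne0$. The graded Clifford algebra $A(M)$ is the algebra generated by $x_1,\dots,x_n$ (degree 1) and $y_1,\dots,y_n$ (degree 2) with relations $x_ix_j+x_jx_i=M_{ij}$, $[x_i,y_j]=0$, $[y_i,y_j]=0$ for $1\le i,j\le n$. *)

(* Defs.v *)
From HB Require Import structures.
From mathcomp Require Import all_boot all_order all_algebra generic_quotient.
(* The notations of multinomials clash with those of mathcomp-analysis. *)
From mathcomp.multinomials Require Import -(notations) monalg mpoly.
From mathcomp Require Import all_classical all_reals all_analysis.
From mathcomp Require Import complex.

Set Implicit Arguments.
Unset Strict Implicit.
Unset Printing Implicit Defensive.

Import Order.TTheory GRing.Theory Num.Theory numFieldNormedType.Exports.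
Local Open Scope classical_set_scope.
Local Open Scope ring_scope.
Local Open Scope complex_scope.
Local Open Scope quotient_scope.

Section TwoSidedQuotient.
Variables (K : nzRingType) (A : lalgType K).

Inductive in_ideal (S : set A) : A -> Prop :=
| ideal_gen r : S r -> in_ideal S r
| ideal_zero : in_ideal S 0
| ideal_add x y : in_ideal S x -> in_ideal S y -> in_ideal S (x + y)
| ideal_mull a x : in_ideal S x -> in_ideal S (a * x)
| ideal_mulr x a : in_ideal S x -> in_ideal S (x * a).

Variable S : set A.

Definition ideal : {pred A} := fun x => `[< in_ideal S x >].

Lemma idealP x : reflect (in_ideal S x) (x \in ideal).
Proof. exact: asboolP. Qed.

Lemma ideal_zmod_closed : zmod_closed ideal.
Proof.
split; first exact/idealP/ideal_zero.
move=> x y /idealP Sx /idealP Sy; apply/idealP/ideal_add => //.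
by rewrite -mulN1r; exact: ideal_mull.
Qed.

HB.instance Definition _ := GRing.isZmodClosed.Build A ideal ideal_zmod_closed.

Definition quot_alg : Type := Quotient.quot ideal.

HB.instance Definition _ := Choice.on quot_alg.
HB.instance Definition _ := GRing.Zmodule.on quot_alg.
HB.instance Definition _ := EqQuotient.on quot_alg.

Definition class (x : A) : quot_alg := \pi x.

Lemma class_eq x y : class x = class y <-> in_ideal S (x - y).
Proof.
rewrite /class; split=> [h|/idealP h].
  by apply/idealP; rewrite Quotient.idealrBE; exact/eqP.
by apply/eqP; rewrite -Quotient.idealrBE.
Qed.

Lemma class_repr (u : quot_alg) : class (repr u) = u.
Proof. exact: reprK. Qed.

Lemma class_add x y : class (x + y) = class x + class y.
Proof. by rewrite /class !piE. Qed.

Definition quot_one : quot_alg := class 1.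
Definition quot_mul (u v : quot_alg) : quot_alg := class (repr u * repr v).
Definition quot_scale (c : K) (u : quot_alg) : quot_alg := class (c *: repr u).

Lemma class_mul x y : quot_mul (class x) (class y) = class (x * y).
Proof.
apply/class_eq; set x' := repr _; set y' := repr _.
have -> : x' * y' - x * y = (x' - x) * y' + x * (y' - y).
  by rewrite mulrBl mulrBr addrA subrK.
by apply: ideal_add; [apply: ideal_mulr|apply: ideal_mull];
  apply/class_eq; rewrite class_repr.
Qed.

Lemma class_scale c x : quot_scale c (class x) = class (c *: x).
Proof.
apply/class_eq; rewrite -scalerBr -[_ - _]mul1r scalerAl.
by apply/ideal_mull/class_eq; rewrite class_repr.
Qed.

Lemma quot_ind (P : quot_alg -> Prop) : (forall x, P (class x)) -> forall u, P u.
Proof. by move=> Pc u; rewrite -(class_repr u). Qed.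

Lemma quot_mulA : associative quot_mul.
Proof.
by do 3!elim/quot_ind=> ?; rewrite !class_mul mulrA.
Qed.

Lemma quot_mul1 : left_id quot_one quot_mul.
Proof. by elim/quot_ind=> x; rewrite class_mul mul1r. Qed.

Lemma quot_mulr1 : right_id quot_one quot_mul.
Proof. by elim/quot_ind=> x; rewrite class_mul mulr1. Qed.

Lemma quot_mulDl : left_distributive quot_mul +%R.
Proof.
by do 3!elim/quot_ind=> ?; rewrite -class_add !class_mul mulrDl class_add.
Qed.

Lemma quot_mulDr : right_distributive quot_mul +%R.
Proof.
by do 3!elim/quot_ind=> ?; rewrite -class_add !class_mul mulrDr class_add.
Qed.

HB.instance Definition _ := GRing.Zmodule_isPzRing.Build quot_alg
  quot_mulA quot_mul1 quot_mulr1 quot_mulDl quot_mulDr.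

Lemma quot_scaleA a b u : quot_scale a (quot_scale b u) = quot_scale (a * b) u.
Proof. by elim/quot_ind: u => x; rewrite !class_scale scalerA. Qed.

Lemma quot_scale1 : left_id 1 quot_scale.
Proof. by elim/quot_ind=> x; rewrite class_scale scale1r. Qed.

Lemma quot_scaleDr : right_distributive quot_scale +%R.
Proof.
by move=> c; do 2!elim/quot_ind=> ?; rewrite -class_add !class_scale scalerDr class_add.
Qed.

Lemma quot_scaleDl u : {morph quot_scale^~ u : a b / a + b}.
Proof.
by elim/quot_ind: u => x a b /=; rewrite !class_scale scalerDl class_add.
Qed.

HB.instance Definition _ := GRing.Zmodule_isLmodule.Build K quot_alg
  quot_scaleA quot_scale1 quot_scaleDr quot_scaleDl.

End TwoSidedQuotient.

Arguments class {K A} S x.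

Section GradedPresentations.
Variable K : comNzRingType.

Definition free_alg (I : choiceType) := malg (fmonom I) K.

Definition gen (I : choiceType) (i : I) : free_alg I := mkmalgU (fmu i) 1.

Record presentation := Presentation {
  gens : choiceType;
  weight : gens -> nat;
  relators : set (free_alg gens) }.

Arguments relators : clear implicits.

Definition presented_alg (P : presentation) : Type :=
  quot_alg (relators P).

HB.instance Definition _ P := GRing.PzRing.on (presented_alg P).
HB.instance Definition _ P := GRing.Lmodule.on (presented_alg P).

Definition homogeneous (P : presentation) (d : nat) (f : free_alg (gens P)) :=
  forall m : fmonom (gens P),
    monalg.mcoeff m f != 0 -> (\sum_(i <- fmonom_val m) weight i = d)%N.

Definition degree_part (P : presentation) (d : nat) : set (presented_alg P) :=
  [set class (relators P) f | f in homogeneous d].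

Arguments degree_part : clear implicits.

(* The zero algebra is not excluded a priori, so that presented algebras are
   not instances of [lalgType]; this is [{lrmorphism _ -> _}] without the
   nontriviality requirement. *)
Definition graded_isomorphic (P Q : presentation) : Prop :=
  exists f : {rmorphism presented_alg P -> presented_alg Q},
    [/\ scalable f, bijective f
      & forall d, f @` degree_part P d = degree_part Q d].

End GradedPresentations.

Arguments relators {K} p.
Arguments degree_part {K} P d.

Section GradedClifford.
Variables (K : comNzRingType) (n : nat).

(* The generators are x_i = inl i and y_k = inr k. *)
Definition clifford_x (i : 'I_n) : free_alg K ('I_n + 'I_n)%type :=
  gen K (inl i).
Definition clifford_y (k : 'I_n) : free_alg K ('I_n + 'I_n)%type :=
  gen K (inr k).

Definition clifford_weight (g : 'I_n + 'I_n) : nat :=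
  match g with inl _ => 1%N | inr _ => 2%N end.

(* A linear form in the commuting variables y_k, read in the free algebra. *)
Definition linear_form (q : mpoly n K) : free_alg K ('I_n + 'I_n)%type :=
  \sum_(k < n) mpoly.mcoeff (mnm1 k) q *: clifford_y k.

Inductive clifford_relator (M : 'M[mpoly n K]_n) :
    set (free_alg K ('I_n + 'I_n)%type) :=
| Clifford_xx i j : clifford_relator M
    (clifford_x i * clifford_x j + clifford_x j * clifford_x i
     - linear_form (M i j))
| Clifford_xy i j : clifford_relator M
    (clifford_x i * clifford_y j - clifford_y j * clifford_x i)
| Clifford_yy i j : clifford_relator M
    (clifford_y i * clifford_y j - clifford_y j * clifford_y i).

Definition graded_clifford (M : 'M[mpoly n K]_n) : presentation K :=
  Presentation clifford_weight (clifford_relator M).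

(* R_2 consists of the polynomials of ordinary degree 1, since deg y_k = 2. *)
Definition clifford_matrix (M : 'M[mpoly n K]_n) : Prop :=
  [/\ M^T = M, forall i j, M i j \is ishomog1 1 mdeg & \det M != 0].

End GradedClifford.

Definition is_graded_clifford (K : comNzRingType) (P : presentation K) : Prop :=
  exists (n : nat) (M : 'M[mpoly n K]_n),
    clifford_matrix M /\ graded_isomorphic P (graded_clifford M).

Section Theta.
Variable R : realType.
Implicit Types eta z : R[i].

Definition cexp z : R[i] :=
  (expR (complex.Re z))%:C * (cos (complex.Im z) +i* sin (complex.Im z)).

Definition e2pii z : R[i] := cexp ((2 * pi)%:C * 'i * z).

Definition theta_term eta z (k : int) : R[i] :=
  (-1) ^ k * e2pii (k%:~R * z + (k * (k - 1))%:~R / 2 * eta).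

(* The sum over all integers, split into k >= 0 and k < 0; both halves converge
   absolutely when 0 < Im eta. *)
Definition theta eta z : R[i] :=
  limn (series (fun k : nat => theta_term eta z k%:Z : R[i]^o))
  + limn (series (fun k : nat => theta_term eta z (- k.+1%:Z) : R[i]^o)).

Definition theta_ (n : nat) eta (alpha : int) z : R[i] :=
  e2pii (alpha%:~R * z
         + (alpha * (alpha - n%:Z))%:~R / (2 * n)%:R * eta
         + alpha%:~R / (2 * n)%:R)
  * \prod_(m < n) theta eta (z + m%:R / n%:R + alpha%:~R / n%:R * eta).

(* theta_alpha depends only on alpha mod n; the representative in [0, n) is
   used. As 'Z_n is the ring Z/nZ only for n > 1, n is assumed to be such. *)
Definition theta_mod (n : nat) eta (alpha : 'Z_n) z : R[i] :=
  theta_ n eta (Posz (val alpha)) z.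

Definition lattice eta : set R[i] :=
  [set z | exists a b : int, z = a%:~R + b%:~R * eta].

(* The class of z in C / lattice eta has order m. *)
Definition has_order eta z (m : nat) : Prop :=
  [/\ (0 < m)%N, lattice eta (z *+ m)
    & forall k, (0 < k < m)%N -> ~ lattice eta (z *+ k)].

Definition sklyanin_relator (n : nat) eta tau (i j : 'Z_n) :
    free_alg R[i] 'Z_n :=
  \sum_(r : 'Z_n)
    (theta_mod eta (j - i) 0
       / (theta_mod eta (j - i - r) (- tau) * theta_mod eta r tau))
    *: (gen _ (j - r) * gen _ (i + r)).

(* Q_{n,1}(E, tau) for E = C / lattice eta, with tau given by a representative
   in C. By quasi-periodicity, another representative multiplies each relator by
   a nonzero scalar. *)
Definition sklyanin (n : nat) eta tau : presentation R[i] :=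
  Presentation (fun _ : 'Z_n => 1%N)
    [set sklyanin_relator eta tau ij.1 ij.2 | ij in [set ij | ij.1 != ij.2]].

End Theta.

(* Main.v *)
Require Import Defs.
From HB Require Import structures.
From mathcomp Require Import all_boot all_order all_algebra.
From mathcomp Require Import reals complex.
From mathcomp Require Import generic_quotient finmap ring lra zify.
From mathcomp.multinomials Require Import -(notations) mpoly monalg.
From mathcomp Require Import all_classical all_reals all_analysis.

(* Put t_a = theta_a(tau).  As 2 tau lies in the lattice, theta_a(-tau) is a
   multiple of t_a by a factor independent of a, so the relations say that
     q(i, a) = sum_r x_{i+a-r} x_{i+r} / (t_{a-r} t_r)
   vanishes for a <> 0.  With zeta a primitive p-th root of unity, the elements
   sum_u zeta^{su} x_{i+u} / t_u (s in Z_p) therefore all have the square q(i, 0),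
   which thus commutes with each of them, hence with every x_j by Fourier
   inversion.  By the addition formula, t_{e+d} t_{e-d} has rank two as a function
   of (e, d), so that the matrix of its inverses, acting on the even functions
   of d, is of Cauchy type and invertible.  Inverting it turns the relations into
     x_j x_k + x_k x_j = c_{(j-k)/2} y_{(j+k)/2},   y_i = 2 q(i, 0),
   where c is a column of the inverse matrix; no c_d vanishes, again because
   Cauchy matrices are invertible, whence the determinant is not 0.

   That theta vanishes at no point outside the lattice comes from the triple
   product; the product formula also expresses theta_a by theta functions of
   modulus n eta, to which the addition formula is applied. *)

Set Implicit Arguments.
Unset Strict Implicit.
Unset Printing Implicit Defensive.

Import Order.TTheory GRing.Theory Num.Theory numFieldNormedType.Exports.
Import Normc.
Local Open Scope classical_set_scope.
Local Open Scope ring_scope.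
Local Open Scope complex_scope.

(** Since p is odd, 2 is invertible modulo p, and every a is some 2e. Symmetrised about k = i + e,
    the relation reads sum_d S(d) / (t_{e+d} t_{e-d}) = 0 for e <> 0, where S(d) = x_{k+d} x_{k-d} +
    x_{k-d} x_{k+d}. As a p by p system this is singular: columns d and -d coincide and, because tau
    = -tau in E, rows e and -e are proportional. This is why everything is carried over to the
    (p+1)/2 classes of Z_p modulo sign. A matrix of inverses 1 / L(e,d) with L of rank two is, up to
    scaling rows and columns, a Cauchy matrix 1 / (X_e - Y_d). The ratios X_e and Y_d may be
    infinite, so invertibility is derived from the factored 2 by 2 minors of L alone. Oddness of p
    has a second use: p tau stays outside the lattice, so the theta function of modulus p eta does
    not vanish at the arguments belonging to tau. No basis or Hilbert series is computed: the
    isomorphism is a pair of mutually inverse maps, checked on generators and relators. *)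

(** * Presented algebras *)

Section FreeAlgebra.
Variables (K : comNzRingType) (I : choiceType).
Implicit Types (f g : free_alg K I) (m : fmonom I) (c : K).

Lemma free_algE f :
  f = \sum_(m <- msupp f) monalg.mcoeff m f *: \prod_(i <- fmonom_val m) gen K i.
Proof.
rewrite {1}[f]monalgE; apply: eq_bigr => m _.
suff -> : \prod_(i <- fmonom_val m) gen K i = mkmalgU m 1.
  by apply/malgP => k; rewrite mcoeffZ !mcoeffU mulrnAr mulr1.
case: m => s /=; elim: s => [|i s IHs] /=.
  rewrite big_nil; congr mkmalgU; exact: fmoneE.
rewrite big_cons IHs /gen; apply/malgP => k.
rewrite [LHS](mcoeffMlw k msuppU_le msuppU_le) !big_seq_fset1 !mcoeffUU mul1r.
rewrite mcoeffU; congr (1 *+ (_ == k)).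
by apply/val_inj; rewrite /= fmM fmU.
Qed.

Lemma free_alg_scaleAr c f g : f * (c *: g) = c *: (f * g).
Proof.
apply/malgP => k.
rewrite [LHS](mcoeffMlw k (fsubset_refl _) (msuppZ_le c g)).
rewrite mcoeffZ mcoeffMl mulr_sumr; apply: eq_bigr => k1 _.
rewrite mulr_sumr; apply: eq_bigr => k2 _.
by rewrite mcoeffZ mulrnAr mulrCA.
Qed.

End FreeAlgebra.

Section Substitution.
Variables (K : comNzRingType) (I J : choiceType) (h : I -> free_alg K J).
Implicit Types (f g : free_alg K I).

Definition word_subst (m : fmonom I) : free_alg K J :=
  \prod_(i <- fmonom_val m) h i.

Lemma word_subst_mmorphism : monalg.mmorphism word_subst.
Proof.
by split=> [m1 m2|]; rewrite /word_subst ?fmM ?big_cat //= fm1 big_nil.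
Qed.

HB.instance Definition _ :=
  monalg.isMultiplicative.Build (fmonom I) (free_alg K J) word_subst
    word_subst_mmorphism.

Definition free_subst : free_alg K I -> free_alg K J :=
  mmap (mkmalgU monalg.one) word_subst.

HB.instance Definition _ := GRing.Additive.on free_subst.

Lemma free_substZ c f : free_subst (c *: f) = c *: free_subst f.
Proof. by rewrite /free_subst mmapZ mul_malgC. Qed.

HB.instance Definition _ :=
  GRing.isScalable.Build K (free_alg K I) (free_alg K J) *:%R free_subst
    free_substZ.

Lemma free_subst_monoid_morphism : monoid_morphism free_subst.
Proof.
have [|fM f1] := @commr_mmap_is_multiplicative (fmonom I) K (free_alg K J)
  (mkmalgU monalg.one) word_subst; last by split.
move=> g m m'; rewrite /GRing.comm mul_malgC.
rewrite -[RHS]/(word_subst m' * mkmalgU monalg.one (monalg.mcoeff m g)).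
by rewrite -[mkmalgU _ _]mulr1 mul_malgC free_alg_scaleAr mulr1.
Qed.

HB.instance Definition _ :=
  GRing.isMonoidMorphism.Build (free_alg K I) (free_alg K J) free_subst
    free_subst_monoid_morphism.

Lemma free_substD : {morph free_subst : f g / f + g}.
Proof. exact: raddfD. Qed.

Lemma free_substB : {morph free_subst : f g / f - g}.
Proof. exact: raddfB. Qed.

Lemma free_substM : {morph free_subst : f g / f * g}.
Proof. exact: rmorphM. Qed.

Lemma free_subst_gen i : free_subst (gen K i) = h i.
Proof.
rewrite /free_subst /gen mmapU mul_malgC scale1r /word_subst fmU.
by rewrite big_seq1.
Qed.

End Substitution.

Section PresentedAlgebra.
Variables (K : comNzRingType) (P : presentation K).
Implicit Types (u v : presented_alg P) (f g : free_alg K (gens P)).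

Definition pclass f : presented_alg P := class (relators P) f.

Lemma pclass_ind (S : presented_alg P -> Prop) :
  (forall f, S (pclass f)) -> forall u, S u.
Proof. exact: quot_ind. Qed.

Lemma pclass_eq f g : pclass f = pclass g <-> in_ideal (relators P) (f - g).
Proof. exact: class_eq. Qed.

Lemma pclass0 f : pclass f = 0 <-> in_ideal (relators P) f.
Proof.
have -> : 0 = pclass 0.
  by apply: (addrI (pclass 0)); rewrite addr0 -class_add addr0.
by rewrite pclass_eq subr0.
Qed.

Lemma pclassD : {morph pclass : f g / f + g}.
Proof. by move=> f g; exact: class_add. Qed.

Lemma pclassM : {morph pclass : f g / f * g}.
Proof. by move=> f g; rewrite -[RHS]/(quot_mul _ _) class_mul. Qed.

Lemma pclassZ c : {morph pclass : f / c *: f}.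
Proof. by move=> f; rewrite -[RHS]/(quot_scale _ _) class_scale. Qed.

Lemma pclassB : {morph pclass : f g / f - g}.
Proof. by move=> f g; apply: (addIr (pclass g)); rewrite subrK -pclassD subrK. Qed.

HB.instance Definition _ :=
  GRing.isZmodMorphism.Build (free_alg K (gens P)) (presented_alg P) pclass pclassB.

Lemma pclass_monoid_morphism : monoid_morphism pclass.
Proof. by split; [|exact: pclassM]. Qed.

HB.instance Definition _ :=
  GRing.isMonoidMorphism.Build (free_alg K (gens P)) (presented_alg P) pclass
    pclass_monoid_morphism.

HB.instance Definition _ :=
  GRing.isScalable.Build K (free_alg K (gens P)) (presented_alg P) *:%R pclass
    pclassZ.

Lemma presented_scaleAl c u v : (c *: u) * v = c *: (u * v).
Proof.
elim/pclass_ind: u => f; elim/pclass_ind: v => g.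
by rewrite -linearZ -!rmorphM -linearZ /= scalerAl.
Qed.

Lemma presented_scaleAr c u v : u * (c *: v) = c *: (u * v).
Proof.
elim/pclass_ind: u => f; elim/pclass_ind: v => g.
by rewrite -linearZ -!rmorphM -linearZ /= free_alg_scaleAr.
Qed.

Definition pgen (i : gens P) : presented_alg P := pclass (gen K i).

(** Words in the generators span the algebra. This principle reduces the equality of two morphisms
    to the generators. *)
Lemma presented_ind (S : presented_alg P -> Prop) :
    (forall i, S (pgen i)) -> S 1 ->
    (forall u v, S u -> S v -> S (u + v)) -> S 0 ->
    (forall u v, S u -> S v -> S (u * v)) ->
    (forall c u, S u -> S (c *: u)) ->
  forall u, S u.
Proof.
move=> Sgen S1 SD S0 SM SZ; elim/pclass_ind => f.
rewrite [f]free_algE raddf_sum /=; apply: (big_ind S) => // m _.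
rewrite linearZ /=; apply: SZ; rewrite rmorph_prod /=.
by apply: (big_ind S) => // i _; exact: Sgen.
Qed.

End PresentedAlgebra.

Section Homogeneous.
Variables (K : comNzRingType) (P : presentation K).
Implicit Types f g : free_alg K (gens P).

Lemma homogeneous0 d : homogeneous d (0 : free_alg K (gens P)).
Proof. by move=> m; rewrite mcoeff0 eqxx. Qed.

Lemma homogeneousD d f g :
  homogeneous d f -> homogeneous d g -> homogeneous d (f + g).
Proof.
move=> hf hg m; rewrite mcoeffD.
have [->|/hf //] := eqVneq (mcoeff m f) 0; rewrite add0r; exact: hg.
Qed.

Lemma homogeneousZ d c f : homogeneous d f -> homogeneous d (c *: f).
Proof.
move=> hf m; rewrite mcoeffZ.
by have [->|/hf //] := eqVneq (mcoeff m f) 0; rewrite mulr0 eqxx.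
Qed.

Lemma homogeneous_sum d (T : Type) (s : seq T) (F : T -> free_alg K (gens P)) :
  (forall i, homogeneous d (F i)) -> homogeneous d (\sum_(i <- s) F i).
Proof.
move=> hF; apply: (big_ind (homogeneous d)) => //.
- exact: homogeneous0.
- by move=> x y; exact: homogeneousD.
Qed.

Lemma homogeneous1 : homogeneous 0 (1 : free_alg K (gens P)).
Proof.
move=> m; rewrite mcoeff1; case: (m =P monalg.one) => [-> _|_ /eqP//].
by rewrite fm1 big_nil.
Qed.

Lemma homogeneousM d e f g :
  homogeneous d f -> homogeneous e g -> homogeneous (d + e) (f * g).
Proof.
move=> hf hg m; rewrite mcoeff_neq0 => /msuppM_le[k1 [k2 [fk1 gk2 ->]]].
by rewrite fmM big_cat /= (hf k1) ?(hg k2) ?mcoeff_neq0.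
Qed.

Lemma homogeneous_prod (T : Type) (s : seq T) (w : T -> nat)
    (F : T -> free_alg K (gens P)) :
  (forall i, homogeneous (w i) (F i)) ->
  homogeneous (\sum_(i <- s) w i) (\prod_(i <- s) F i).
Proof.
move=> hF; elim: s => [|i s IHs]; first by rewrite !big_nil; exact: homogeneous1.
by rewrite !big_cons; apply: homogeneousM.
Qed.

Lemma homogeneous_gen i : homogeneous (weight i) (gen K i : free_alg K (gens P)).
Proof.
move=> m; rewrite /gen mcoeffU; case: (fmu i =P m) => [<- _|_ /eqP//].
by rewrite fmU big_seq1.
Qed.

End Homogeneous.

Lemma in_ideal_rmorph (K : comNzRingType) (A : lalgType K) (B : pzRingType)
    (F : {rmorphism A -> B}) (S : set A) x :
  (forall r, S r -> F r = 0) -> in_ideal S x -> F x = 0.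
Proof.
move=> FS; elim=> {x} [r|||a x _ IHx|x a _ IHx]; first exact: FS.
- by rewrite rmorph0.
- by move=> x y _ IHx _ IHy; rewrite rmorphD IHx IHy addr0.
- by rewrite rmorphM IHx mulr0.
- by rewrite rmorphM IHx mul0r.
Qed.

Section PresentedMap.
Variables (K : comNzRingType) (P Q : presentation K).
Variable h : gens P -> free_alg K (gens Q).

Definition respects_relators : Prop :=
  forall r, relators P r -> pclass (free_subst h r) = 0 :> presented_alg Q.

Hypothesis hrel : respects_relators.

(* The unused argument lets the morphism instances below be attached. *)
Definition presented_map (_ : respects_relators) (u : presented_alg P) :
  presented_alg Q := pclass (free_subst h (repr u)).

Local Notation phi := (presented_map hrel).

Lemma presented_map_class f : phi (pclass f) = pclass (free_subst h f).
Proof.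
rewrite /presented_map; apply/pclass_eq; rewrite -raddfB /=; apply/pclass0.
have : in_ideal (relators P) (repr (pclass f) - f).
  by apply/pclass_eq; exact: class_repr.
exact: (in_ideal_rmorph (F := @pclass K Q \o free_subst h)).
Qed.

Lemma presented_map_zmod_morphism : zmod_morphism phi.
Proof.
elim/pclass_ind => f; elim/pclass_ind => g.
by rewrite -raddfB !presented_map_class !raddfB.
Qed.

HB.instance Definition _ :=
  GRing.isZmodMorphism.Build (presented_alg P) (presented_alg Q) phi
    presented_map_zmod_morphism.

Lemma presented_map_monoid_morphism : monoid_morphism phi.
Proof.
split; first by rewrite -[1](rmorph1 (@pclass K P)) presented_map_class !rmorph1.
elim/pclass_ind => f; elim/pclass_ind => g.
by rewrite -pclassM !presented_map_class free_substM pclassM.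
Qed.

HB.instance Definition _ :=
  GRing.isMonoidMorphism.Build (presented_alg P) (presented_alg Q) phi
    presented_map_monoid_morphism.

Lemma presented_mapZ : scalable phi.
Proof.
move=> c; elim/pclass_ind => f.
by rewrite -linearZ /= !presented_map_class free_substZ linearZ.
Qed.

HB.instance Definition _ :=
  GRing.isScalable.Build K (presented_alg P) (presented_alg Q) *:%R phi
    presented_mapZ.

Lemma presented_mapD : {morph phi : u v / u + v}.
Proof. exact: raddfD. Qed.

Lemma presented_mapM : {morph phi : u v / u * v}.
Proof. exact: rmorphM. Qed.

Lemma presented_map_gen i : phi (pgen i) = pclass (h i).
Proof. by rewrite /pgen presented_map_class free_subst_gen. Qed.

Lemma presented_map_degree d :
  (forall i, homogeneous (weight i) (h i)) ->
  phi @` degree_part P d `<=` degree_part Q d.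
Proof.
move=> hh _ [_ [f hf <-] <-]; rewrite presented_map_class.
exists (free_subst h f) => //.
rewrite [f]free_algE raddf_sum /= big_seq.
apply: (big_ind (homogeneous d)) => [||m].
- exact: homogeneous0.
- by move=> x y; exact: homogeneousD.
rewrite -mcoeff_neq0 => /hf <-; rewrite free_substZ; apply: homogeneousZ.
rewrite rmorph_prod (eq_bigr h) => [|i _]; last exact: free_subst_gen.
exact: homogeneous_prod.
Qed.

End PresentedMap.

(** Each map sends degree parts into degree parts; applied to the inverse, this makes the image of a
    degree part the whole degree part. *)
Lemma graded_isomorphic_maps (K : comNzRingType) (P Q : presentation K)
    (h : gens P -> free_alg K (gens Q)) (k : gens Q -> free_alg K (gens P))
    (hrel : respects_relators h) (krel : respects_relators k) :
  (forall i, homogeneous (weight i) (h i)) ->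
  (forall i, homogeneous (weight i) (k i)) ->
  (forall i, presented_map krel (pclass (h i)) = pgen i) ->
  (forall i, presented_map hrel (pclass (k i)) = pgen i) ->
  graded_isomorphic P Q.
Proof.
move=> hh hk kh hk'.
have khK : cancel (presented_map hrel) (presented_map krel).
  elim/presented_ind => [i||u v IHu IHv||u v IHu IHv|c u IHu].
  - by rewrite presented_map_gen.
  - by rewrite !rmorph1.
  - by rewrite (presented_mapD hrel) (presented_mapD krel); congr (_ + _).
  - by rewrite !raddf0.
  - by rewrite (presented_mapM hrel) (presented_mapM krel); congr (_ * _).
  - by rewrite (presented_mapZ hrel) (presented_mapZ krel) IHu.
have hkK : cancel (presented_map krel) (presented_map hrel).
  elim/presented_ind => [i||u v IHu IHv||u v IHu IHv|c u IHu].
  - by rewrite presented_map_gen.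
  - by rewrite !rmorph1.
  - by rewrite (presented_mapD krel) (presented_mapD hrel); congr (_ + _).
  - by rewrite !raddf0.
  - by rewrite (presented_mapM krel) (presented_mapM hrel); congr (_ * _).
  - by rewrite (presented_mapZ krel) (presented_mapZ hrel) IHu.
exists (presented_map hrel); split; first exact: presented_mapZ.
  by exists (presented_map krel).
move=> d; apply/seteqP; split; first exact: presented_map_degree.
move=> v dv; exists (presented_map krel v); last exact: hkK.
by apply: (@presented_map_degree _ _ _ _ krel d hk); exists v.
Qed.

(** * Matrices of Cauchy type *)

(* Multiplying the equation of row i by the entry in column j0, and subtracting
   the same for row i0, eliminates column j0 and leaves a system of the same
   shape. *)
Lemma cauchy_kernel (K : fieldType) (I J : eqType) (L : I -> J -> K)
    (u : I -> I -> K) (v : J -> J -> K) :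
  (forall i i' j j', L i j * L i' j' - L i j' * L i' j = u i i' * v j j') ->
  forall (s : seq J) (r : seq I) (c : J -> K), (size s <= size r)%N ->
    uniq s -> uniq r ->
    {in r & s, forall i j, L i j != 0} ->
    {in r &, forall i i', i != i' -> u i i' != 0} ->
    {in s &, forall j j', j != j' -> v j j' != 0} ->
    {in r, forall i, \sum_(j <- s) c j / L i j = 0} ->
  {in s, forall j, c j = 0}.
Proof.
move=> Luv; elim=> [|j0 s IHs] [|i0 r] // c szr /andP[j0s us] /andP[i0r ur].
move=> Lnz unz vnz sum0.
have inr i : i \in r -> i \in i0 :: r by rewrite inE orbC => ->.
have ins j : j \in s -> j \in j0 :: s by rewrite inE orbC => ->.
have i0i := mem_head i0 r; have j0j := mem_head j0 s.
(* After the elimination the coefficient of [c j] is [L i j0 / L i j - L i0 j0 / L i0 j], which by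
   the minor identity equals [u i i0 * v j0 j / (L i j * L i0 j)]. The factor [u i i0] is common to
   the row and cancels; the rest is absorbed into the new unknowns. *)
have cs0 : {in s, forall j, c j * v j0 j / L i0 j = 0}.
  apply: (IHs r (fun j => c j * v j0 j / L i0 j)) => //.
  - by move=> i j /inr ir /ins js; exact: Lnz.
  - by move=> i i' /inr ir /inr ir'; exact: unz.
  - by move=> j j' /ins js /ins js'; exact: vnz.
  move=> i ir; have i0Ni : i != i0 by apply: contraNneq i0r => <-.
  apply: (mulfI (unz _ _ (inr _ ir) i0i i0Ni)); rewrite /= mulr0 mulr_sumr.
  transitivity (L i j0 * (\sum_(j <- j0 :: s) c j / L i j)
     - L i0 j0 * (\sum_(j <- j0 :: s) c j / L i0 j)); last first.
    by rewrite (sum0 i (inr i ir)) (sum0 i0 i0i) !mulr0 subrr.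
  rewrite !big_cons !mulrDr ![L _ j0 * (_ / _)]mulrC.
  rewrite (divfK (Lnz i j0 (inr i ir) j0j)) (divfK (Lnz i0 j0 i0i j0j)).
  rewrite opprD addrACA subrr add0r !mulr_sumr -sumrB.
  apply: eq_big_seq => j js.
  have Lij : L i j != 0 by rewrite Lnz ?inr ?ins.
  have Li0j : L i0 j != 0 by rewrite Lnz ?ins.
  apply: (mulIf Lij); apply: (mulIf Li0j) => /=.
  have E : u i i0 * (c j * v j0 j / L i0 j / L i j) * L i j * L i0 j =
    c j * (u i i0 * v j0 j) by field; rewrite Lij Li0j.
  rewrite E -Luv; by field; rewrite Lij Li0j.
have c0 : {in s, forall j, c j = 0}.
  move=> j js; have /eqP := cs0 j js; rewrite !mulf_eq0 invr_eq0.
  rewrite (negbTE (Lnz _ _ i0i (ins _ js))) orbF.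
  have /negbTE -> : v j0 j != 0.
    by apply: vnz (ins _ js) _ => //; apply: contraNneq j0s => ->.
  by rewrite orbF => /eqP.
move=> j; rewrite inE => /predU1P[->|/c0 //].
have /eqP := sum0 _ i0i; rewrite big_cons big_seq big1 ?addr0.
  by rewrite mulf_eq0 invr_eq0 (negbTE (Lnz _ _ i0i j0j)) orbF => /eqP.
by move=> k /c0 ->; rewrite mul0r.
Qed.

(** * Functions on Z/p modulo sign *)

Section EvenFunctions.
Variables (p : nat) (p_gt1 : (1 < p)%N) (p_odd : odd p).
Local Notation m := p./2.
Implicit Types (d e : 'Z_p) (k l : 'I_m.+1).

(* [half_rep] and [fold_pm] identify [{0, ..., (p-1)/2}] with Z_p modulo sign. *)
Definition half_rep k : 'Z_p := inZp k.
Definition fold_pm d : 'I_m.+1 := inord (minn d (p - d)).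

Lemma val_half_rep k : val (half_rep k) = k.
Proof.
rewrite /= modn_small // Zp_cast //; have := ltn_ord k; have := odd_double_half p.
by rewrite p_odd; lia.
Qed.

Lemma val_oppZp d : val (- d) = ((p - d) %% p)%N.
Proof. by rewrite /=; congr ((_ - _) %% _)%N; exact: Zp_cast. Qed.

Lemma ltn_Zp d : (d < p)%N.
Proof. by rewrite -[X in (_ < X)%N](Zp_cast p_gt1). Qed.

Lemma val_fold_pm d : val (fold_pm d) = minn d (p - d).
Proof.
rewrite /= inordK //; have := ltn_Zp d; have := odd_double_half p.
by rewrite p_odd; lia.
Qed.

Lemma half_rep_fold_pm d : half_rep (fold_pm d) = d \/ half_rep (fold_pm d) = - d.
Proof.
have dp := ltn_Zp d.
have [le|lt] := leqP d (p - d).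
  by left; apply/val_inj; rewrite val_half_rep val_fold_pm; apply/minn_idPl.
right; apply/val_inj; rewrite val_half_rep val_fold_pm val_oppZp.
by rewrite modn_small; lia.
Qed.

(** Opposite nonzero classes would need k + l = p, while k + l is at most p - 1. *)
Lemma half_rep_pm k l : half_rep k = half_rep l \/ half_rep k = - half_rep l -> k = l.
Proof.
have := ltn_ord k; have := ltn_ord l; have := odd_double_half p; rewrite p_odd.
move=> pm lt_l lt_k [/(congr1 val)|/(congr1 val)].
  by rewrite !val_half_rep => /val_inj.
rewrite val_oppZp !val_half_rep => E; apply/val_inj => /=; move: E.
have [->|l0] := posnP l; first by rewrite subn0 modnn.
by rewrite modn_small; lia.
Qed.

Lemma half_repK k : fold_pm (half_rep k) = k.
Proof. exact/half_rep_pm/half_rep_fold_pm. Qed.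

Lemma half_rep0 : half_rep ord0 = 0.
Proof. by apply/val_inj; rewrite val_half_rep. Qed.

Lemma fold_pmN d : fold_pm (- d) = fold_pm d.
Proof.
apply: half_rep_pm.
case: (half_rep_fold_pm (- d)) => ->; case: (half_rep_fold_pm d) => ->;
  by rewrite ?opprK; auto.
Qed.

Lemma fold_pm_eq0 d : (fold_pm d == ord0) = (d == 0).
Proof.
apply/eqP/eqP => [E|->].
  by case: (half_rep_fold_pm d); rewrite E half_rep0 => /esym // /eqP;
    rewrite oppr_eq0 => /eqP.
by apply: half_rep_pm; rewrite half_rep0; case: (half_rep_fold_pm 0) => ->;
   rewrite ?oppr0; auto.
Qed.

(** The size of a class modulo sign: 1 at 0 and 2 elsewhere. Kept as a cardinal, it spares the case
    distinction in [sum_even]. *)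
Definition fold_mult (K : pzSemiRingType) l : K := #|[pred d | fold_pm d == l]|%:R.

Lemma fold_mult_neq0 (K : numDomainType) l : fold_mult K l != 0.
Proof.
rewrite pnatr_eq0 -lt0n; apply/card_gt0P; exists (half_rep l).
by rewrite inE half_repK.
Qed.

Lemma even_half_rep (T : Type) (S : 'Z_p -> T) :
  (forall d, S (- d) = S d) -> forall d, S (half_rep (fold_pm d)) = S d.
Proof. by move=> SN d; case: (half_rep_fold_pm d) => ->. Qed.

Lemma sum_even (K : pzRingType) (V : lmodType K) (S : 'Z_p -> V) :
    (forall d, S (- d) = S d) ->
  \sum_d S d = \sum_l fold_mult K l *: S (half_rep l).
Proof.
move=> SN; rewrite (partition_big fold_pm predT) //=; apply: eq_bigr => l _.
rewrite scaler_nat -sumr_const; apply: eq_bigr => d /eqP <-.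
by rewrite even_half_rep.
Qed.

(** Removing one row and one column, of possibly different indices, leaves a square system to which
    the Cauchy criterion applies again. *)
Lemma mem_filter_enum_neq l : uniq [seq k <- enum 'I_m.+1 | k != l] /\
  size [seq k <- enum 'I_m.+1 | k != l] = m.
Proof.
split; first by rewrite filter_uniq ?enum_uniq.
rewrite size_filter; apply: (@addnI (count_mem l (enum 'I_m.+1))).
by rewrite count_predC size_enum_ord count_uniq_mem ?enum_uniq // mem_enum.
Qed.

End EvenFunctions.

(** * Inversion of the matrix of inverses of a rank-two kernel, on even functions *)

Section RankTwoKernel.
Variables (K : numFieldType) (p : nat) (p_gt1 : (1 < p)%N) (p_odd : odd p).
Variables (L u v : 'Z_p -> 'Z_p -> K).
Hypothesis L_neq0 : forall e d, L e d != 0.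
Hypothesis L_even : forall e d, L e (- d) = L e d.
Hypothesis L_opp : forall e, exists2 r, r != 0 & forall d, L (- e) d = r * L e d.
Hypothesis L_minor : forall e e' d d',
  L e d * L e' d' - L e d' * L e' d = u e e' * v d d'.
Hypothesis u_neq0 : forall e e', e != e' -> e != - e' -> u e e' != 0.
Hypothesis v_neq0 : forall d d', d != d' -> d != - d' -> v d d' != 0.

Local Notation m := p./2.
Local Notation rep := (@half_rep p).

(** The operator taking an even S to the function of e given by the sum of S(d) / L(e,d), written in
    the classes modulo sign; the weights count the d in each class. *)
Let W : 'M[K]_m.+1 := \matrix_(k, l) (fold_mult K l / L (rep k) (rep l)).

Let kernel (s r : seq 'I_m.+1) (c : 'I_m.+1 -> K) :
  (size s <= size r)%N -> uniq s -> uniq r ->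
  {in r, forall k, \sum_(l <- s) c l / L (rep k) (rep l) = 0} ->
  {in s, forall l, c l = 0}.
Proof.
have neq k l : k != l -> rep k != rep l /\ rep k != - rep l.
  by move=> kl; split; apply: contraNneq kl => E;
    apply/eqP/(half_rep_pm p_gt1 p_odd); auto.
move=> szr us ur; apply: (cauchy_kernel (L := fun k l => L (rep k) (rep l))
  (u := fun k l => u (rep k) (rep l)) (v := fun k l => v (rep k) (rep l))) => //.
- by move=> k k' _ _ /neq[]; exact: u_neq0.
- by move=> l l' _ _ /neq[]; exact: v_neq0.
Qed.

Let W_unit : W \in unitmx.
Proof.
rewrite -unitmx_tr -row_free_unit; apply: inj_row_free => x xW.
have x0 : {in enum 'I_m.+1, forall l, x 0 l * fold_mult K l = 0}.
  apply: (@kernel _ (enum 'I_m.+1)); rewrite ?enum_uniq // => k _.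
  have /rowP/(_ k) := xW; rewrite !mxE => E; rewrite -[RHS]E big_enum /=.
  by apply: eq_bigr => l _; rewrite !mxE mulrA.
apply/rowP => l; rewrite mxE; have /eqP := x0 l (mem_enum _ l).
by rewrite mulf_eq0 (negbTE (fold_mult_neq0 _ _ _ _)) // orbF => /eqP.
Qed.

Let Z := invmx W.

(** The right-hand sides are supported at e = 0, so only column 0 of the inverse of [W] occurs; [c]
    is that column, extended to an even function. The last clause is stated for vectors in a module
    because S will consist of anticommutators in an algebra. *)
Lemma rank_two_inverse : exists c : 'Z_p -> K,
  [/\ forall d, c (- d) = c d,
      forall d, c d != 0,
      forall e, \sum_d c d / L e d = (e == 0)%:R
    & forall (V : lmodType K) (S : 'Z_p -> V) (Y : V),
        (forall d, S (- d) = S d) ->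
        (forall e, \sum_d (L e d)^-1 *: S d = (e == 0)%:R *: Y) ->
      forall d, S d = c d *: Y].
Proof.
pose c d := Z (fold_pm d) ord0.
have cN d : c (- d) = c d by rewrite /c fold_pmN.
have crep l : c (rep l) = Z l ord0 by rewrite /c half_repK.
have sumW (V : lmodType K) (S : 'Z_p -> V) k : (forall d, S (- d) = S d) ->
    \sum_d (L (rep k) d)^-1 *: S d = \sum_l W k l *: S (rep l).
  move=> SN; rewrite (sum_even p_gt1 p_odd) => [|d]; last by rewrite SN L_even.
  by apply: eq_bigr => l _; rewrite scalerA mxE.
have sumc k : \sum_d c d / L (rep k) d = (k == ord0)%:R.
  under eq_bigr do rewrite mulrC.
  rewrite (sumW _ (c : 'Z_p -> K^o)) //.
  have /matrixP/(_ k ord0) := mulmxV W_unit; rewrite !mxE => <-.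
  by apply: eq_bigr => l _; rewrite crep.
exists c; split=> // [d|e|V S Y SN sumS d].
(* If [c] vanished at [l0], its other entries would solve the homogeneous square system of the rows
   other than 0 and the columns other than [l0]. Then the whole column would be 0, against the
   equation of row 0. *)
- rewrite -(even_half_rep p_gt1 p_odd cN) crep; set l0 := fold_pm d.
  apply/eqP => Zl0; have [us szs] := mem_filter_enum_neq l0.
  have [ur szr] := @mem_filter_enum_neq p ord0.
  have c0 : {in [seq k <- enum 'I_m.+1 | k != l0],
      forall l, Z l ord0 * fold_mult K l = 0}.
    have sz : (size [seq k <- enum 'I_m.+1 | k != l0] <=
        size [seq k <- enum 'I_m.+1 | k != ord0])%N by rewrite szs szr.
    apply: (kernel sz us ur) => k.
    rewrite mem_filter => /andP[k0 _].
    rewrite big_filter big_enum_cond /=.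
    have /matrixP/(_ k ord0) := mulmxV W_unit; rewrite !mxE (negbTE k0) => E.
    rewrite -[RHS]E [RHS](bigD1 l0) //= Zl0 mulr0 add0r.
    by apply: eq_bigr => l _; rewrite mxE; ring.
  have /matrixP/(_ ord0 ord0) := mulmxV W_unit; rewrite !mxE eqxx => E.
  move/eqP: (oner_neq0 K); apply; transitivity (\sum_l W ord0 l * Z l ord0).
    exact: esym E.
  apply: big1 => l _.
  have [->|ll0] := eqVneq l l0; first by rewrite Zl0 mulr0.
  have l_in : l \in [seq k <- enum 'I_m.+1 | k != l0] by rewrite mem_filter ll0 mem_enum.
  have /eqP := c0 l l_in.
  by rewrite mulf_eq0 (negbTE (fold_mult_neq0 _ _ _ _)) // orbF => /eqP ->;
     rewrite mulr0.
(* The inverse gives the equations for representatives only. Row [e] is a multiple of the row of its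
   representative, which suffices where the right-hand side is 0; at [e = 0] the multiple is 1, as
   comparison at the nonzero entry [L 0 0] shows. *)
- have [r r0 Lr] := L_opp (rep (fold_pm e)).
  have Le : exists2 r, r != 0 & forall d, L e d = r * L (rep (fold_pm e)) d.
    case: (half_rep_fold_pm p_gt1 p_odd e) => E.
      by exists 1; rewrite ?oner_neq0 // => d; rewrite E mul1r.
    by exists r => // d; rewrite -Lr E opprK.
  have [r' r'0 Lr'] := Le.
  transitivity (r'^-1 * (fold_pm e == ord0)%:R).
    rewrite -sumc mulr_sumr; apply: eq_bigr => d _.
    by rewrite Lr' invfM; ring.
  rewrite fold_pm_eq0 //; have [e0|] := eqVneq e 0; last by rewrite mulr0.
  move: Lr'; rewrite e0.
  have -> : fold_pm (0 : 'Z_p) = ord0 by apply/eqP; rewrite fold_pm_eq0.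
  rewrite half_rep0 // => /(_ 0); rewrite -[LHS]mul1r => /(mulIf (L_neq0 _ _)) <-.
  by rewrite invr1 mulr1.
(* Left multiplication of the system by [Z]: its right-hand side is [Y] in row 0 and 0 elsewhere,
   which leaves column 0 of [Z] times [Y]. *)
- rewrite -(even_half_rep p_gt1 p_odd SN) -(even_half_rep p_gt1 p_odd cN) crep.
  set l := fold_pm d.
  transitivity (\sum_k Z l k *: \sum_l' W k l' *: S (rep l')).
    under eq_bigr do rewrite scaler_sumr.
    rewrite exchange_big /=.
    transitivity (\sum_l' (Z *m W) l l' *: S (rep l')).
      rewrite mulVmx // (bigD1 l) //= big1 ?addr0 => [|k kl].
        by rewrite !mxE eqxx scale1r.
      by rewrite !mxE eq_sym (negbTE kl) scale0r.
    apply: eq_bigr => l' _; rewrite mxE scaler_suml.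
    by apply: eq_bigr => k _; rewrite scalerA.
  have sumWS k : \sum_l' W k l' *: S (rep l') = (rep k == 0)%:R *: Y.
    by rewrite -sumS; apply: esym; exact: sumW.
  under eq_bigr do rewrite sumWS; rewrite (bigD1 ord0) // big1 ?addr0 => [|k k0].
    by rewrite half_rep0 // eqxx mulr1n scale1r; exact: addr0.
  suff -> : (rep k == 0) = false by rewrite scale0r scaler0.
  by rewrite -(fold_pm_eq0 p_gt1 p_odd) half_repK // (negbTE k0).
Qed.

End RankTwoKernel.

(** * Quadratic relations on Z/p *)

Lemma sum_unity_root (K : numFieldType) (p : nat) (z : K) :
  p.-primitive_root z -> forall a b : 'I_p,
  \sum_(s < p) (z ^+ a / z ^+ b) ^+ s = if a == b then p%:R else 0.
Proof.
move=> pz a b; have z_neq0 : z != 0.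
  have : z ^+ p != 0 by rewrite prim_expr_order ?oner_neq0.
  by rewrite expf_eq0 (prim_order_gt0 pz).
have [->|ab] := eqVneq a b.
  by under eq_bigr do rewrite divff ?expf_neq0 // expr1n; rewrite sumr_const card_ord.
have q1 : z ^+ a / z ^+ b - 1 != 0.
  rewrite subr_eq0; apply: contra ab => /eqP E.
  have : z ^+ a = z ^+ b by rewrite -[RHS]mul1r -E divfK ?expf_neq0.
  by move/eqP; rewrite (eq_prim_root_expr pz) !modn_small.
apply: (mulfI q1); rewrite mulr0 -subrX1 exprMn exprVn -!exprM !(mulnC _ p) !exprM.
by rewrite (prim_expr_order pz) !expr1n invr1 mulr1 subrr.
Qed.

Section QuadraticRelations.
Variables (K : numFieldType) (p : nat) (p_gt1 : (1 < p)%N) (p_odd : odd p).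
Variables (t : 'Z_p -> K) (A : lmodType K) (mul : A -> A -> A).
Implicit Types (x : 'Z_p -> A).
Local Notation "u '**' v" := (mul u v) (at level 40, left associativity).

(** The element q(i, a) of the overview. The product is a parameter so that the same sum can be
    formed in free algebras and in presented algebras, which are not instances of [lalgType]. *)
Definition rel_sum x i a := \sum_r (t (a - r) * t r)^-1 *: (x (i + a - r) ** x (i + r)).

Definition half_Zp : 'Z_p := (p./2.+1)%:R.
Local Notation q := half_Zp.

Lemma half_ZpD : q + q = 1.
Proof.
rewrite -natrD; have -> : (p./2.+1 + p./2.+1)%N = p.+1.
  by have := odd_double_half p; rewrite p_odd; lia.
by rewrite -natr1 pchar_Zp // add0r.
Qed.

Lemma half_ZpM (a : 'Z_p) : q * a + q * a = a.
Proof. by rewrite -mulrDl half_ZpD mul1r. Qed.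

Lemma addrr_Zp_eq0 (a : 'Z_p) : (a + a == 0) = (a == 0).
Proof.
apply/eqP/eqP => [aa|->]; last exact: addr0.
by rewrite -[a]half_ZpM -mulrDr aa mulr0.
Qed.

(** Both r = e - d and r = e + d run through the terms of q(k - e, 2e), once with each order of the
    two factors; hence the factor 2. *)
Lemma rel_sum_anticomm x k e :
  \sum_d (t (e + d) * t (e - d))^-1 *: (x (k + d) ** x (k - d) + x (k - d) ** x (k + d))
    = 2%:R *: rel_sum x (k - e) (e + e).
Proof.
rewrite scaler_nat mulr2n; under eq_bigr do rewrite scalerDr.
rewrite big_split /=; congr (_ + _).
  rewrite /rel_sum (reindex_inj (inv_inj (subKr e))) /=.
  by apply: eq_bigr => r _; congr ((t _ * t _)^-1 *: (x _ ** x _)); ring.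
rewrite /rel_sum (reindex_inj (addIr (- e))) /=.
apply: eq_bigr => r _; rewrite mulrC.
by congr ((t _ * t _)^-1 *: (x _ ** x _)); ring.
Qed.

Section Central.
Hypotheses (mulDl : left_distributive mul +%R) (mulDr : right_distributive mul +%R).
Hypotheses (mulZl : forall c u v, (c *: u) ** v = c *: (u ** v))
  (mulZr : forall c u v, u ** (c *: v) = c *: (u ** v)).
Hypothesis mulA : associative mul.
Hypothesis t_neq0 : forall a, t a != 0.
Variables (z : K) (z_prim : p.-primitive_root z).
Variable x : 'Z_p -> A.
Hypothesis rel0 : forall i a, a != 0 -> rel_sum x i a = 0.

Let mul_suml (I : finType) (F : I -> A) v : (\sum_i F i) ** v = \sum_i F i ** v.
Proof.
apply: (big_morph (fun u => u ** v)) => [u u'|]; first exact: mulDl.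
by rewrite -[X in X ** _](scale0r (0 : A)) mulZl scale0r.
Qed.

Let mul_sumr (I : finType) (F : I -> A) v : v ** (\sum_i F i) = \sum_i v ** F i.
Proof.
apply: (big_morph (fun u => v ** u)) => [u u'|]; first exact: mulDr.
by rewrite -[X in _ ** X](scale0r (0 : A)) mulZr scale0r.
Qed.

Let chi s (a : 'Z_p) : K := z ^+ (s * a).

Let chiD s a b : chi s (a + b) = chi s a * chi s b.
Proof.
rewrite /chi -exprD -mulnDr -(prim_expr_mod z_prim) -[in RHS](prim_expr_mod z_prim).
congr (z ^+ _); rewrite -modnMmr -[in RHS]modnMmr; congr ((_ * _) %% _)%N.
rewrite -[RHS]modn_mod; congr (_ %% p)%N.
by rewrite -[RHS]/(_ %% p)%N /=; congr (_ %% _)%N; exact: Zp_cast.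
Qed.

Let xi s i := \sum_u (chi s u / t u) *: x (i + u).

(* The terms of the square of [xi s i] are collected by [a = u + v]: only [a = 0]
   survives, so that all the [xi s i] are square roots of one element, which
   commutes with all of them. *)
Let xi_sqr s i : xi s i ** xi s i = rel_sum x i 0.
Proof.
rewrite /xi mul_suml.
transitivity (\sum_a chi s a *: rel_sum x i a); last first.
  rewrite (bigD1 0) //= big1 ?addr0 => [|a a0]; last by rewrite rel0 ?scaler0.
  by rewrite /chi muln0 expr0 scale1r.
transitivity (\sum_u \sum_v (chi s (u + v) / (t u * t v)) *: (x (i + u) ** x (i + v))).
  apply: eq_bigr => u _; rewrite mul_sumr; apply: eq_bigr => v _.
  rewrite mulZl mulZr scalerA chiD invfM.
  by congr (_ *: _); ring.
rewrite exchange_big /=.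
under eq_bigr => v _.
  rewrite (reindex_inj (addIr (- v))) /=.
  over.
rewrite exchange_big /=; apply: eq_bigr => a _.
rewrite /rel_sum scaler_sumr; apply: eq_bigr => r _.
by rewrite subrK scalerA addrA.
Qed.

Lemma rel_sum0_comm i j : x j ** rel_sum x i 0 = rel_sum x i 0 ** x j.
Proof.
set Y := rel_sum x i 0; pose D a := x a ** Y - Y ** x a.
have Dxi s : \sum_u (chi s u / t u) *: D (i + u) = 0.
  transitivity (xi s i ** Y - Y ** xi s i); last first.
    by rewrite /Y -(xi_sqr s) mulA subrr.
  rewrite mul_suml mul_sumr -sumrB; apply: eq_bigr => u _.
  by rewrite mulZl mulZr -scalerBr.
suff D0 v : D (i + v) = 0.
  have -> : j = i + (j - i) by rewrite addrC subrK.
  exact: subr0_eq (D0 _).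
(* Orthogonality of the characters reduces the left-hand side to [p / t v] times [D (i + v)]. *)
have : \sum_(s < p) (chi s v)^-1 *: (\sum_u (chi s u / t u) *: D (i + u)) = 0.
  by rewrite big1 // => s _; rewrite Dxi scaler0.
under eq_bigr do rewrite scaler_sumr.
rewrite exchange_big /=.
pose ord (a : 'Z_p) : 'I_p := cast_ord (Zp_cast p_gt1) a.
under eq_bigr => u _.
  have -> : \sum_(s < p) (chi s v)^-1 *: ((chi s u / t u) *: D (i + u)) =
      ((if ord u == ord v then p%:R else 0) / t u) *: D (i + u).
    rewrite -(sum_unity_root z_prim) mulr_suml scaler_suml; apply: eq_bigr => s _.
    rewrite scalerA /chi exprMn exprVn -!exprM; congr (_ *: _).
    by rewrite /= ![(s * _)%N]mulnC; ring.
  over.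
rewrite (bigD1 v) //= eqxx big1 ?addr0 => [|u uv]; last first.
  by rewrite (inj_eq (@cast_ord_inj _ _ _)) (negbTE uv) mul0r scale0r.
move/eqP; rewrite scaler_eq0 mulf_eq0 invr_eq0 (negbTE (t_neq0 v)) orbF pnatr_eq0.
by rewrite gtn_eqF ?(ltnW p_gt1) //= => /eqP.
Qed.

Lemma rel_sum0_comm_rel_sum0 i j :
  rel_sum x i 0 ** rel_sum x j 0 = rel_sum x j 0 ** rel_sum x i 0.
Proof.
rewrite [in LHS]/(rel_sum x j 0) [in RHS]/(rel_sum x j 0) mul_sumr mul_suml.
apply: eq_bigr => r _; rewrite mulZl mulZr; congr (_ *: _).
by rewrite mulA -rel_sum0_comm -!mulA -rel_sum0_comm.
Qed.

Lemma scale_rel_sum0_comm b i j :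
  x j ** (b *: rel_sum x i 0) = (b *: rel_sum x i 0) ** x j.
Proof. by rewrite mulZl mulZr rel_sum0_comm. Qed.

Lemma scale_rel_sum0_comm2 b i j :
  (b *: rel_sum x i 0) ** (b *: rel_sum x j 0) =
    (b *: rel_sum x j 0) ** (b *: rel_sum x i 0).
Proof. by rewrite !mulZl !mulZr rel_sum0_comm_rel_sum0. Qed.

End Central.

Variable c : 'Z_p -> K.

(** The direction from Clifford to Sklyanin: centred at i + a/2, all anticommutators are multiples
    of one y, and their coefficients add up to row a/2 of the matrix applied to [c], which is 1 or
    0. *)
Lemma rel_sum_clifford x (y : 'Z_p -> A) :
    (forall e, \sum_d c d / (t (e + d) * t (e - d)) = (e == 0)%:R) ->
    (forall j k, x j ** x k + x k ** x j = c (q * (j - k)) *: y (q * (j + k))) ->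
  forall i a, 2%:R *: rel_sum x i a = (a == 0)%:R *: y (i + q * a).
Proof.
move=> sumc xy i a.
set e := q * a; set k := i + e.
transitivity (2%:R *: rel_sum x (k - e) (e + e)).
  by rewrite /k addrK half_ZpM.
rewrite -rel_sum_anticomm -(half_ZpM a) addrr_Zp_eq0 -/e.
rewrite -sumc scaler_suml; apply: eq_bigr => d _.
rewrite xy scalerA mulrC; congr (c _ / _ *: y _).
  by rewrite -[RHS]half_ZpM -mulrDr; congr (_ * _); ring.
by rewrite -[RHS]half_ZpM -mulrDr; congr (_ * _); ring.
Qed.

Lemma rel_sum_clifford_eq0 x (y : 'Z_p -> A) :
    (forall e, \sum_d c d / (t (e + d) * t (e - d)) = (e == 0)%:R) ->
    (forall j k, x j ** x k + x k ** x j = c (q * (j - k)) *: y (q * (j + k))) ->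
  forall i a, a != 0 -> rel_sum x i a = 0.
Proof.
move=> sumc xy i a a0; apply/eqP.
have /eqP := rel_sum_clifford sumc xy i a.
by rewrite (negbTE a0) scale0r scaler_eq0 pnatr_eq0.
Qed.

(** The direction from Sklyanin to Clifford: about the midpoint of j and k the anticommutator is an
    even function of d that solves the linear system with right-hand side concentrated at e = 0. *)
Lemma anticomm_rel_sum x :
    (forall (S : 'Z_p -> A) (Y : A), (forall d, S (- d) = S d) ->
        (forall e, \sum_d (t (e + d) * t (e - d))^-1 *: S d = (e == 0)%:R *: Y) ->
      forall d, S d = c d *: Y) ->
    (forall i a, a != 0 -> rel_sum x i a = 0) ->
  forall j k, x j ** x k + x k ** x j =
    c (q * (j - k)) *: (2%:R *: rel_sum x (q * (j + k)) 0).
Proof.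
move=> inv rel0 j k.
set i := q * (j + k); set d := q * (j - k).
have -> : j = i + d by rewrite -[LHS]half_ZpM /i /d -!mulrDr; congr (_ * _); ring.
have -> : k = i - d.
  by rewrite -[LHS]half_ZpM /i /d -mulrBr -mulrDr; congr (_ * _); ring.
pose S d := x (i + d) ** x (i - d) + x (i - d) ** x (i + d).
rewrite -[LHS]/(S d); apply: inv => [d'|e]; first by rewrite /S opprK addrC.
rewrite rel_sum_anticomm; have [->|e0] := eqVneq e 0.
  by rewrite subr0 addr0 scale1r.
by rewrite rel0 ?addrr_Zp_eq0 // scaler0 scale0r.
Qed.

End QuadraticRelations.

(** * The isomorphism with a graded Clifford algebra *)

Lemma clifford_respects (K : comNzRingType) (n : nat) (M : 'M[mpoly.mpoly n K]_n)
    (P : presentation K) (h : 'I_n + 'I_n -> free_alg K (gens P))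
    (X Y : 'I_n -> presented_alg P) :
    (forall i, pclass (h (inl i)) = X i) -> (forall i, pclass (h (inr i)) = Y i) ->
    (forall i j, X i * X j + X j * X i =
      \sum_k mpoly.mcoeff (mpoly.mnm1 k) (M i j) *: Y k) ->
    (forall i j, X i * Y j = Y j * X i) -> (forall i j, Y i * Y j = Y j * Y i) ->
  @respects_relators K (graded_clifford M) P h.
Proof.
move=> hX hY XX XY YY.
pose F u := @pclass K P (free_subst h u).
have FM u v : F (u * v) = F u * F v by rewrite /F free_substM pclassM.
have FD u v : F (u + v) = F u + F v by rewrite /F free_substD pclassD.
have FB u v : F (u - v) = F u - F v by rewrite /F free_substB pclassB.
have FX i : F (clifford_x K i) = X i by rewrite /F free_subst_gen hX.
have FY i : F (clifford_y K i) = Y i by rewrite /F free_subst_gen hY.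
have Fl q : F (linear_form q) = \sum_k mpoly.mcoeff (mpoly.mnm1 k) q *: Y k.
  rewrite /F /linear_form (raddf_sum (free_subst h)) (raddf_sum (@pclass K P)).
  apply: eq_bigr => k _; rewrite -FY -pclassZ.
  exact: (congr1 (@pclass K P) (free_substZ h _ _)).
suff: forall r, clifford_relator M r -> F r = 0 by [].
move: F FM FD FB FX FY Fl => F FM FD FB FX FY Fl _ [] i j; rewrite FB.
- move: (Fl (M i j)) (FX i) (FX j).
  move: (linear_form _) (clifford_x K i) (clifford_x K j) => l u v Fl' Fu Fv.
  rewrite FD; apply: (etrans (f_equal2 (fun a b => a + b - F l) (FM u v) (FM v u))).
  by rewrite Fl' Fu Fv XX subrr.
- move: (FX i) (FY j); move: (clifford_x K i) (clifford_y K j) => u v Fu Fv.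
  apply: (etrans (f_equal2 (fun a b => a - b) (FM u v) (FM v u))).
  by rewrite Fu Fv XY subrr.
- move: (FY i) (FY j); move: (clifford_y K i) (clifford_y K j) => u v Fu Fv.
  apply: (etrans (f_equal2 (fun a b => a - b) (FM u v) (FM v u))).
  by rewrite Fu Fv YY subrr.
Qed.

Section ThetaAlgebra.
Variables (K : numFieldType) (p : nat) (p_gt1 : (1 < p)%N) (p_odd : odd p).
Variables (w t t' : 'Z_p -> K).

Definition theta_relator (i j : 'Z_p) : free_alg K 'Z_p :=
  \sum_(r : 'Z_p) (w (j - i) / (t' (j - i - r) * t r))
    *: (gen _ (j - r) * gen _ (i + r)).

(** With [w], [t'], [t] the values of the theta functions at 0, -tau, tau this unfolds to the
    Sklyanin presentation. What follows uses of these values only that they do not vanish where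
    required, that [t'] is proportional to [t], and the properties of [c]. *)
Definition theta_algebra : presentation K :=
  Presentation (fun _ : 'Z_p => 1%N)
    [set theta_relator ij.1 ij.2 | ij in [set ij | ij.1 != ij.2]].

Hypothesis t_neq0 : forall a, t a != 0.
Hypothesis w_neq0 : forall a, a != 0 -> w a != 0.
Hypothesis t'E : exists2 k, k != 0 & forall a, t' a = k * t a.

Lemma map_rel_sum (I : choiceType) (A : lmodType K) (mul : A -> A -> A)
    (F : {linear free_alg K I -> A}) (f : 'Z_p -> free_alg K I) i a :
    (forall u v, F (u * v) = mul (F u) (F v)) ->
  F (rel_sum t *%R f i a) = rel_sum t mul (fun j => F (f j)) i a.
Proof.
move=> FM; rewrite /rel_sum raddf_sum; apply: eq_bigr => r _.
by rewrite /= linearZ /= FM.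
Qed.

Lemma theta_relatorE : exists2 k, k != 0 & forall i a,
  theta_relator i (i + a) = (w a / k) *: rel_sum t *%R (@gen K _) i a.
Proof.
have [k k0 t'k] := t'E; exists k => // i a.
rewrite /theta_relator /rel_sum scaler_sumr; apply: eq_bigr => r _.
have -> : i + a - i = a by ring.
by rewrite scalerA t'k -mulrA !invfM !mulrA.
Qed.

Local Notation Q := (presented_alg theta_algebra).
Let x : 'Z_p -> Q := @pgen K theta_algebra.
Let rel_theta := @rel_sum K p t Q *%R x.

Lemma theta_rel_sum_eq0 i a : a != 0 -> rel_theta i a = 0.
Proof.
move=> a0; have [k k0 E] := theta_relatorE.
have rel0 : @pclass K theta_algebra (theta_relator i (i + a)) = 0.
  apply/pclass0/ideal_gen; exists (i, i + a) => //=.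
  by rewrite -[X in X != _]addr0 (inj_eq (addrI i)) eq_sym.
have : (w a / k) *: rel_theta i a = 0.
  rewrite -rel0 E pclassZ; congr (_ *: _); apply: esym.
  exact: (@map_rel_sum _ Q *%R (@pclass K theta_algebra) (@gen K _) i a
    (@pclassM _ theta_algebra)).
move/(congr1 (fun v => (k / w a) *: v)); rewrite scaler0 scalerA.
have -> : k / w a * (w a / k) = 1 by field; rewrite k0 w_neq0.
by rewrite scale1r.
Qed.

Variable c : 'Z_p -> K.
Hypothesis c_even : forall d, c (- d) = c d.
Hypothesis c_neq0 : forall d, c d != 0.
Hypothesis sum_c : forall e, \sum_d c d / (t (e + d) * t (e - d)) = (e == 0)%:R.

Local Notation n := (Zp_trunc p).+2.
Local Notation q := (half_Zp p).

Definition theta_matrix : 'M[mpoly.mpoly n K]_n :=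
  \matrix_(j, k) (c (q * (j - k)) *: mpoly.mpolyX K (mpoly.mnm1 (q * (j + k)))).

Lemma theta_matrixP : clifford_matrix theta_matrix.
Proof.
split.
- apply/matrixP => j k; by rewrite !mxE -(opprB j k) mulrN c_even [k + j]addrC.
- move=> j k; rewrite mxE; apply: mpoly.dhomogZ.
  by rewrite mpoly.dhomogX; apply/eqP/mpoly.mdeg1.
(* Setting y_0 = 1 and the other variables to 0 keeps only the entries with j + k = 0, where (j -
   k)/2 = j: a monomial matrix with the nonzero entries [c j]. *)
pose v (k : 'I_n) : K := (k == 0)%:R.
suff : mpoly.meval v (\det theta_matrix) != 0.
  by apply: contra => /eqP ->; rewrite mpoly.meval0.
rewrite -det_map_mx; set B := map_mx _ _.
have BE j k : B j k = c j *+ (k == - j).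
  rewrite !mxE /= mpoly.mevalZ mpoly.mevalXU /v.
  have -> : (q * (j + k) == 0) = (k == - j).
    by rewrite -addrr_Zp_eq0 // half_ZpM // addrC addr_eq0.
  have [->|] := eqVneq k (- j); last by rewrite mulr0.
  by rewrite opprK mulrDr half_ZpM // mulr1.
pose D : 'M[K]_n := \matrix_(j, k) ((c k)^-1 *+ (k == - j)).
have BD : B *m D = 1%:M.
  apply/matrixP => j k; rewrite !mxE (bigD1 (- j)) //= big1 ?addr0 => [|l lj].
    rewrite BE eqxx mxE opprK mulr1n [k == j]eq_sym.
    by have [->|_] := eqVneq j k; rewrite ?mulr0 // mulr1n divff.
  by rewrite BE (negbTE lj) mul0r.
by have [] := mulmx1_unit BD; rewrite unitmxE unitfE.
Qed.

Local Notation C := (presented_alg (graded_clifford theta_matrix)).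
Let X (j : 'Z_p) : C := @pgen K (graded_clifford theta_matrix) (inl j).
Let Yc (j : 'Z_p) : C := @pgen K (graded_clifford theta_matrix) (inr j).

Lemma sum_theta_matrix (V : lmodType K) (y : 'I_n -> V) j k :
  \sum_l mpoly.mcoeff (mnm1 l) (theta_matrix j k) *: y l =
    c (q * (j - k)) *: y (q * (j + k)).
Proof.
rewrite mxE (bigD1 (q * (j + k))) //= big1 => [|l lm].
  by rewrite addr0 mpoly.mcoeffZ mpoly.mcoeffX eqxx mulr1.
rewrite mpoly.mcoeffZ mpoly.mcoeffX.
suff /negbTE -> : mnm1 (q * (j + k)) != mnm1 l by rewrite mulr0 scale0r.
apply: contra lm => /eqP/(congr1 (fun m : multinom n => m l)).
by rewrite !mnm1E eqxx; case: eqP => // ->.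
Qed.

Lemma linear_form_theta_matrix j k :
  linear_form (theta_matrix j k) = c (q * (j - k)) *: clifford_y K (q * (j + k)).
Proof. exact: sum_theta_matrix. Qed.

Lemma clifford_anticomm j k :
  X j * X k + X k * X j = c (q * (j - k)) *: Yc (q * (j + k)).
Proof.
rewrite /X /Yc /pgen -!pclassM -pclassD -pclassZ; apply/pclass_eq.
by rewrite -linear_form_theta_matrix; apply: ideal_gen; exact: Clifford_xx.
Qed.

Definition theta_to_clifford (j : 'Z_p) : free_alg K ('I_n + 'I_n)%type :=
  clifford_x K j.

Definition clifford_to_theta (g : 'I_n + 'I_n) : free_alg K 'Z_p :=
  match g with
  | inl j => gen K j
  | inr j => 2%:R *: rel_sum t *%R (@gen K _) j 0
  end.

Let pclass_rel_sum (P : presentation K) (f : 'Z_p -> free_alg K (gens P)) i a :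
  pclass (rel_sum t *%R f i a) =
    rel_sum t (@GRing.mul (presented_alg P)) (fun j => pclass (f j)) i a.
Proof. exact: (@map_rel_sum _ _ _ (@pclass K P) f i a (@pclassM _ P)). Qed.

Let free_subst_rel_sum (I J : choiceType) (h : I -> free_alg K J)
    (f : 'Z_p -> free_alg K I) i a :
  free_subst h (rel_sum t *%R f i a) = rel_sum t *%R (fun j => free_subst h (f j)) i a.
Proof.
exact: (@map_rel_sum _ (free_alg K J) *%R (free_subst h) f i a (@free_substM _ _ _ h)).
Qed.

Let two_rel_sum_X i a : 2%:R *: rel_sum t (@GRing.mul C) X i a = (a == 0)%:R *: Yc (i + q * a).
Proof. exact: (rel_sum_clifford p_gt1 p_odd sum_c clifford_anticomm). Qed.

Lemma theta_to_clifford_respects :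
  @respects_relators K theta_algebra (graded_clifford theta_matrix) theta_to_clifford.
Proof.
move=> _ [[i j] /= ij <-]; have [k k0 E] := theta_relatorE.
have -> : j = i + (j - i) by rewrite addrC subrK.
rewrite E free_substZ pclassZ free_subst_rel_sum pclass_rel_sum.
have -> : (fun l : 'Z_p => @pclass K (graded_clifford theta_matrix)
    (free_subst theta_to_clifford (gen K l))) = X.
  by apply/funext => l; rewrite free_subst_gen.
rewrite (rel_sum_clifford_eq0 p_gt1 p_odd sum_c clifford_anticomm).
  exact: scaler0.
by rewrite subr_eq0 eq_sym.
Qed.

Variables (z : K) (z_prim : p.-primitive_root z).
Hypothesis c_inv : forall (V : lmodType K) (S : 'Z_p -> V) (Y : V),
    (forall d, S (- d) = S d) ->
    (forall e, \sum_d (t (e + d) * t (e - d))^-1 *: S d = (e == 0)%:R *: Y) ->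
  forall d, S d = c d *: Y.

Let theta_anticomm j k : x j * x k + x k * x j =
  c (q * (j - k)) *: (2%:R *: rel_theta (q * (j + k)) 0).
Proof.
by apply: (anticomm_rel_sum p_gt1 p_odd (@c_inv Q) theta_rel_sum_eq0).
Qed.

Let theta_central i j : x j * (2%:R *: rel_theta i 0) = (2%:R *: rel_theta i 0) * x j.
Proof.
exact: (@scale_rel_sum0_comm K p p_gt1 t Q *%R (@mulrDl Q) (@mulrDr Q)
  (@presented_scaleAl K theta_algebra) (@presented_scaleAr K theta_algebra)
  (@mulrA Q) t_neq0 z z_prim x theta_rel_sum_eq0 2%:R i j).
Qed.

Let theta_central2 i j : (2%:R *: rel_theta i 0) * (2%:R *: rel_theta j 0) =
  (2%:R *: rel_theta j 0) * (2%:R *: rel_theta i 0).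
Proof.
exact: (@scale_rel_sum0_comm2 K p p_gt1 t Q *%R (@mulrDl Q) (@mulrDr Q)
  (@presented_scaleAl K theta_algebra) (@presented_scaleAr K theta_algebra)
  (@mulrA Q) t_neq0 z z_prim x theta_rel_sum_eq0 2%:R i j).
Qed.

Lemma clifford_to_theta_respects :
  @respects_relators K (graded_clifford theta_matrix) theta_algebra clifford_to_theta.
Proof.
apply: (@clifford_respects K n theta_matrix theta_algebra clifford_to_theta x
  (fun j => 2%:R *: rel_theta j 0)) => [i|i|i j|i j|i j].
- by [].
- by rewrite /clifford_to_theta pclassZ pclass_rel_sum.
- by rewrite theta_anticomm sum_theta_matrix.
- exact: theta_central.
- exact: theta_central2.
Qed.

Lemma theta_algebra_graded_clifford : is_graded_clifford theta_algebra.
Proof.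
exists n, theta_matrix; split; first exact: theta_matrixP.
apply: (graded_isomorphic_maps (hrel := theta_to_clifford_respects)
  (krel := clifford_to_theta_respects)).
- by move=> j; apply: homogeneous_gen.
- case=> j /=; first exact: homogeneous_gen.
  apply: homogeneousZ; apply: homogeneous_sum => r; apply: homogeneousZ.
  by apply: (@homogeneousM K theta_algebra 1 1); exact: homogeneous_gen.
- by move=> j; rewrite presented_map_class free_subst_gen.
(* The composite sends y_j to 2 q(j, 0) formed in the Clifford algebra, and the case a = 0 of
   [two_rel_sum_X] identifies this with y_j. *)
- case=> j; first by rewrite presented_map_class free_subst_gen.
  rewrite presented_map_class free_substZ pclassZ free_subst_rel_sum pclass_rel_sum.
  have -> : (fun l : 'Z_p => @pclass K (graded_clifford theta_matrix)
    (free_subst theta_to_clifford (gen K l))) = X.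
    by apply/funext => l; rewrite free_subst_gen.
  by rewrite two_rel_sum_X eqxx mulr0 addr0 scale1r.
Qed.

End ThetaAlgebra.

(** * The theta series *)

Section ComplexExponential.
Variable R : realType.
Implicit Types z w : R[i].
Local Notation e := (@e2pii R).

Lemma cexpD z w : cexp (z + w) = cexp z * cexp w.
Proof.
case: z w => [a b] [c d]; rewrite /cexp /= expRD cosD sinD.
by apply/eqP; rewrite eq_complex /=; apply/andP; split; apply/eqP; ring.
Qed.

Lemma e2piiD z w : e (z + w) = e z * e w.
Proof. by rewrite /e2pii mulrDr cexpD. Qed.

Lemma e2pii0 : e 0 = 1.
Proof.
rewrite /e2pii mulr0 /cexp /= expR0 cos0 sin0.
by apply/eqP; rewrite eq_complex /=; simpc.
Qed.

Lemma e2pii_neq0 z : e z != 0.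
Proof.
have : e z * e (- z) != 0 by rewrite -e2piiD subrr e2pii0 oner_neq0.
by rewrite mulf_eq0 negb_or => /andP[].
Qed.

Lemma e2piiN z : e (- z) = (e z)^-1.
Proof.
apply: (mulfI (e2pii_neq0 z)).
by rewrite -e2piiD subrr e2pii0 divff ?e2pii_neq0.
Qed.

Lemma e2piiB z w : e (z - w) = e z / e w.
Proof. by rewrite e2piiD e2piiN. Qed.

Lemma e2piiMn z n : e (z *+ n) = e z ^+ n.
Proof.
by elim: n => [|n IHn]; rewrite ?mulr0n ?e2pii0 // mulrS e2piiD IHn exprS.
Qed.

Lemma e2piiE (a b : R) : e (a +i* b) =
  (expR (- (2 * pi * b)))%:C * (cos (2 * pi * a) +i* sin (2 * pi * a)).
Proof.
rewrite /e2pii /cexp; congr ((expR _)%:C * (cos _ +i* sin _)) => /=; ring.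
Qed.

Lemma e2pii1 : e 1 = 1.
Proof.
rewrite -[1 in LHS]/(1 +i* 0) e2piiE mulr0 oppr0 expR0 mulr1 mulr_natl.
by rewrite cos2pi sin2pi mul1r.
Qed.

Lemma e2pii_int (k : int) : e k%:~R = 1.
Proof.
have en n : e n%:R = 1 by rewrite e2piiMn e2pii1 expr1n.
case: k => n; first exact: en.
by rewrite NegzE mulrNz e2piiN en invr1.
Qed.

Lemma norm_e2pii z : `|e z| = (expR (- (2 * pi * complex.Im z)))%:C.
Proof.
case: z => a b; rewrite e2piiE normrM; set t := expR _.
rewrite normc_def /= expr0n addr0 sqrtr_sqr ger0_norm ?expR_ge0 //.
by rewrite normc_def /= cos2Dsin2 sqrtr1 mulr1.
Qed.

(** The modulus forces z to be real. For the fractional part f, cos(2 pi f) = 1 gives sin(pi f) = 0,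
    while the sine is positive between 0 and pi. *)
Lemma e2pii_eq1 z : e z = 1 -> exists k : int, z = k%:~R.
Proof.
case: z => a b eab; have := norm_e2pii (a +i* b); rewrite eab normr1 /=.
move=> /(congr1 (@complex.Re R)) /= /esym/(congr1 (@ln R)); rewrite expRK ln1.
move/eqP; rewrite oppr_eq0 !mulf_eq0 pnatr_eq0 (gt_eqF (pi_gt0 R)) /= => /eqP b0.
pose k := Num.floor a; pose f := a - k%:~R.
have f01 : 0 <= f < 1.
  have /andP[ka ak] := real_floor_itv (num_real a).
  by rewrite subr_ge0 ka ltrBlDl -[X in _ + X]/(1%:~R) -intrD.
have : e (f +i* 0) = 1.
  rewrite -eab b0; have -> : f +i* 0 = a +i* 0 - k%:~R.
    by rewrite -(rmorph_int (real_complex R)); apply/eqP; rewrite eq_complex /= subr0 !eqxx.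
  by rewrite e2piiB e2pii_int divr1.
rewrite e2piiE mulr0 oppr0 expR0 mul1r => /(congr1 (@complex.Re R)) /=.
have -> : 2 * pi * f = (pi * f) *+ 2 by ring.
rewrite cos_mulr2n cos2sin2 => cf.
have /eqP : sin (pi * f) ^+ 2 = 0 by move: cf; rewrite -mulr_natl; lra.
rewrite expf_eq0 /= => /eqP sf; exists k.
have f0 : f = 0.
  apply/eqP; rewrite eq_le (andP f01).1 andbT leNgt; apply/negP => f_gt0.
  have : 0 < sin (pi * f).
    apply: sin_gt0_pi; rewrite mulr_gt0 ?pi_gt0 //= -[ltRHS]mulr1.
    by rewrite ltr_pM2l ?pi_gt0 // (andP f01).2.
  by rewrite sf ltxx.
by rewrite -(rmorph_int (real_complex R)) b0 -[a](subrK k%:~R) -/f f0 add0r.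
Qed.

Lemma e2pii_half : e (1 / 2) = -1.
Proof.
have : e (1 / 2) ^+ 2 = 1.
  rewrite -e2piiMn; have -> : (1 / 2) *+ 2 = 1 :> R[i] by field.
  exact: e2pii1.
move/eqP; rewrite sqrf_eq1 => /orP[/eqP/e2pii_eq1[k k2]|/eqP //].
have : (k * 2)%:~R = 1%:~R :> R[i] by rewrite intrM -k2; field.
by move/intr_inj; lia.
Qed.

End ComplexExponential.

(** * Limits of complex sequences and bounds for infinite products *)

Section ComplexLimits.
Variable R : realType.
Implicit Types (u v a : nat -> R[i]) (l : R[i]).

(** Phrased through the real-valued modulus so that all estimates take place in [R]; [climP] links
    it to the topological limit in the definition of theta. *)
Definition clim u l : Prop := (fun n => normc (u n - l)) @ \oo --> (0 : R).

Lemma normc_ge0 (z : R[i]) : 0 <= normc z.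
Proof. by case: z => x y; rewrite /normc sqrtr_ge0. Qed.

Lemma clim_le u l (d : nat -> R) :
  (forall n, normc (u n - l) <= d n) -> d @ \oo --> (0 : R) -> clim u l.
Proof.
move=> ud d0; apply: (squeeze_cvgr _ (cvg_cst (0 : R)) d0).
by near=> n; rewrite normc_ge0 ud.
Unshelve. all: by end_near.
Qed.

Lemma climP u l : clim u l <-> (u : nat -> R[i]^o) @ \oo --> (l : R[i]^o).
Proof.
split=> [ul|ul].
  apply/cvgrPdist_lt => -[e e'] e0; have e'0 : e' = 0.
    by move: e0; rewrite ltcE /= => /andP[/eqP].
  move: e0; rewrite e'0 ltcR => e_gt0.
  move/cvgrPdist_lt: ul => /(_ e e_gt0); apply: filterS => n.
  by rewrite sub0r normrN ger0_norm ?normc_ge0 // distrC => ?; rewrite ltcR.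
apply/cvgrPdist_lt => e e_gt0.
have ec : 0 < e%:C by rewrite ltcR.
move/cvgrPdist_lt: ul => /(_ _ ec); apply: filterS => n.
by rewrite distrC ltcR sub0r normrN ger0_norm ?normc_ge0.
Qed.

Lemma clim_lim u l : clim u l -> limn (u : nat -> R[i]^o) = l.
Proof. by move/climP/cvg_lim; apply. Qed.

Lemma clim_cst l : clim (fun=> l) l.
Proof. by apply: (@clim_le _ _ (fun=> 0)) => [n|]; [rewrite subrr normc0|exact: cvg_cst]. Qed.

Lemma climD u v l m : clim u l -> clim v m -> clim (fun n => u n + v n) (l + m).
Proof.
move=> ul vm.
apply: (@clim_le _ _ (fun n => normc (u n - l) + normc (v n - m))) => [n|].
  by rewrite opprD addrACA le_normcD.
by rewrite -[0 in X in _ --> X](addr0 0); apply: cvgD.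
Qed.

Lemma climM u v l m : clim u l -> clim v m -> clim (fun n => u n * v n) (l * m).
Proof.
move=> ul vm.
apply: (@clim_le _ _ (fun n => normc (u n - l) * (normc (v n - m) + normc m)
    + normc l * normc (v n - m))) => [n|].
  have -> : u n * v n - l * m = (u n - l) * (v n - m + m) + l * (v n - m) by ring.
  apply: le_trans (le_normcD _ _) _; rewrite !normcM lerD2r ler_wpM2l ?normc_ge0 //.
  exact: le_normcD.
have -> : 0 = 0 * (0 + normc m) + normc l * 0 by rewrite mul0r mulr0 addr0.
apply: cvgD; last by apply: cvgM => //; exact: cvg_cst.
by apply: cvgM => //; apply: cvgD => //; exact: cvg_cst.
Qed.

Lemma climZ k u l : clim u l -> clim (fun n => k * u n) (k * l).
Proof. by apply: climM; exact: clim_cst. Qed.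

Lemma climB u v l m : clim u l -> clim v m -> clim (fun n => u n - v n) (l - m).
Proof.
move=> ul vm; have := climD ul (climZ (-1) vm); rewrite mulN1r.
by congr (clim _ _); apply/funext => n; rewrite mulN1r.
Qed.

Lemma clim_uniq u l m : clim u l -> clim u m -> l = m.
Proof.
move=> ul um; apply/eqP; rewrite -subr_eq0; apply/eqP/eq0_normc.
have := climB um ul; rewrite /clim => lm.
have E : (fun n => normc (u n - u n - (m - l))) = (fun=> normc (l - m)).
  by apply/funext => n; rewrite subrr sub0r opprB.
move: lm; rewrite E => lm.
by rewrite -(cvg_unique _ lm (cvg_cst _)).
Qed.

Lemma clim_prod (n : nat) (u : 'I_n -> nat -> R[i]) (l : 'I_n -> R[i]) :
  (forall m, clim (u m) (l m)) -> clim (fun N => \prod_m u m N) (\prod_m l m).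
Proof.
move=> ul.
have -> : (fun N => \prod_m u m N) = fun N => \prod_(m <- enum 'I_n) u m N.
  by apply/funext => N; rewrite big_enum.
rewrite -big_enum; elim: (enum _) => [|m s IHs].
  rewrite big_nil; have := clim_cst 1; congr (clim _ _).
  by apply/funext => N; rewrite big_nil.
rewrite big_cons; have := climM (ul m) IHs; congr (clim _ _).
by apply/funext => N; rewrite big_cons.
Qed.

Lemma clim_comp u l (f : nat -> nat) :
  (forall n, (n <= f n)%N) -> clim u l -> clim (u \o f) l.
Proof.
move=> nf; apply: cvg_comp.
move=> A [N _ NA]; exists N => //= n /= Nn; apply: NA => /=.
exact: leq_trans Nn (nf n).
Qed.

Lemma clim_sub u v l : clim u l -> clim (fun n => u n - v n) 0 -> clim v l.
Proof.
move=> ul uv; have := climB ul uv; rewrite subr0; congr (clim _ _).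
by apply/funext => n; rewrite subKr.
Qed.

Lemma cvg_geometric0 (M r : R) : 0 <= r < 1 -> (fun n => M * r ^+ n) @ \oo --> (0 : R).
Proof.
by move=> /andP[r0 r1]; apply: cvg_geometric; rewrite ger0_norm.
Qed.

Lemma ler_Re_normc (z : R[i]) : `|complex.Re z| <= normc z.
Proof. by have := normc_ge_Re z; rewrite lecR. Qed.

Lemma ler_Im_normc (z : R[i]) : `|complex.Im z| <= normc z.
Proof.
case: z => x y /=; rewrite -sqrtr_sqr ler_wsqrtr // lerDr sqr_ge0 //.
Qed.

Lemma normc_le_ReIm (z : R[i]) : normc z <= `|complex.Re z| + `|complex.Im z|.
Proof.
case: z => x y /=; rewrite -[leRHS]ger0_norm ?addr_ge0 // -sqrtr_sqr ler_wsqrtr //.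
by rewrite sqrrD !real_normK ?num_real // lerD2r lerDl mulrn_wge0 ?mulr_ge0.
Qed.

(** The real and imaginary parts are dominated by the modulus, so each converges by comparison with
    a real geometric series. *)
Lemma clim_geometric a (M r : R) : 0 <= r < 1 -> (forall k, normc (a k) <= M * r ^+ k) ->
  exists l, clim (fun n => \sum_(0 <= k < n) a k) l.
Proof.
move=> r01 aM.
have cvg_part (f : R[i] -> R) : {morph f : x y / x + y} -> f 0 = 0 ->
    (forall z, `|f z| <= normc z) ->
  exists l : R, (fun n => f (\sum_(0 <= k < n) a k)) @ \oo --> l.
  move=> fD f0 fle.
  have : cvgn (series (f \o a)).
    apply: normed_cvg.
    apply: (@series_le_cvg _ _ (fun k => M * r ^+ k)) => [k|k|k|].
    - exact: normr_ge0.
    - exact: le_trans (normc_ge0 _) (aM k).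
    - exact: le_trans (fle _) (aM k).
    by apply: is_cvg_geometric_series; case/andP: r01 => r0 r1; rewrite ger0_norm.
  move=> /cvg_ex[l sl]; exists l; apply: cvg_trans sl; apply: near_eq_cvg.
  by apply: nearW => n; rewrite /series /= (big_morph f fD f0).
have [||x xl] := cvg_part (@complex.Re R) _ _ ler_Re_normc => //.
  by move=> [? ?] [? ?].
have [||y yl] := cvg_part (@complex.Im R) _ _ ler_Im_normc => //.
  by move=> [? ?] [? ?].
exists (x +i* y); set u := fun n => _.
apply: (@clim_le _ _ (fun n => `|complex.Re (u n) - x| + `|complex.Im (u n) - y|)).
  by move=> n; case: (u n) => p q; exact: normc_le_ReIm.
rewrite -[0 in X in _ --> X](addr0 0); apply: cvgD.
  by apply/norm_cvg0P/subr_cvg0.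
by apply/norm_cvg0P/subr_cvg0.
Qed.

Lemma normc_prod (I : Type) (s : seq I) (F : I -> R[i]) :
  normc (\prod_(i <- s) F i) = \prod_(i <- s) normc (F i).
Proof. by apply: (big_morph (@normc R)); [exact: normcM|exact: normc1]. Qed.

Lemma normc_sum (I : Type) (s : seq I) (F : I -> R[i]) :
  normc (\sum_(i <- s) F i) <= \sum_(i <- s) normc (F i).
Proof.
elim: s => [|i s IHs]; first by rewrite !big_nil normc0.
by rewrite !big_cons; apply: le_trans (le_normcD _ _) _; rewrite lerD2l.
Qed.

Lemma ler_normcB (z w : R[i]) : normc z - normc w <= normc (z - w).
Proof. by rewrite lerBlDr; apply: le_trans (le_normcD _ _); rewrite subrK. Qed.

(* Weierstrass' inequality for the factors beyond which the sum of the bounds is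
   at most 1/2 bounds the tail of the product away from 0. *)
Lemma prod_lower_bound u (M r : R) : 0 <= r < 1 ->
    (forall k, normc (u k) <= M * r ^+ k) -> (forall k, u k != 1) ->
  exists2 d : R, 0 < d & forall N, d <= normc (\prod_(0 <= k < N) (1 - u k)).
Proof.
move=> r01 uM u1; have M0 : 0 <= M.
  by apply: le_trans (normc_ge0 (u 0%N)) _; rewrite -[leRHS]mulr1 -(expr0 r) uM.
have /andP[r0 r1] := r01.
have [K KM] : exists K, M * r ^+ K / (1 - r) <= 1 / 2.
  have := cvg_geometric0 (M / (1 - r)) r01.
  move/cvgrPdist_lt => /(_ (1 / 2)) []; first by rewrite divr_gt0.
  move=> K _ /(_ K (leqnn K)); rewrite sub0r normrN => /(le_lt_trans (ler_norm _)).
  by move/ltW => ?; exists K; rewrite mulrAC.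
have tail n : 1 - M * r ^+ K * \sum_(0 <= k < n) r ^+ k <=
    normc (\prod_(0 <= k < n) (1 - u (K + k)%N)).
  elim: n => [|n IHn]; first by rewrite !big_geq // mulr0 subr0 normc1.
  rewrite !big_nat_recr //= normcM mulrDr opprD addrA.
  set S := 1 - _; set P := normc _ in IHn *.
  set y := M * r ^+ K * r ^+ n; have y0 : 0 <= y.
    by rewrite !mulr_ge0 ?exprn_ge0.
  have uy : normc (u (K + n)%N) <= y by rewrite /y -mulrA -exprD.
  have S1 : S <= 1.
    rewrite lerBlDr lerDl mulr_ge0 ?mulr_ge0 ?exprn_ge0 //.
    by apply: sumr_ge0 => k _; exact: exprn_ge0.
  have u1y : 1 - y <= normc (1 - u (K + n)%N).
    apply: le_trans (ler_normcB _ _); rewrite normc1 lerD2l lerN2 //.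
  (* Lower bounds can be multiplied only if both are nonnegative; when [S] or [1 - y] is not
     positive, the claimed bound [S - y] is itself at most 0. *)
  have [S0|S0] := leP S 0.
    apply: (@le_trans _ _ 0); first by rewrite subr_le0 (le_trans S0).
    by rewrite mulr_ge0 ?normc_ge0.
  have [y1|y1] := leP 1 y.
    apply: (@le_trans _ _ 0); first by rewrite subr_le0 (le_trans S1).
    by rewrite mulr_ge0 ?normc_ge0.
  apply: (@le_trans _ _ (S * (1 - y))); first by rewrite mulrBr mulr1 lerD2l lerN2 ler_piMl.
  by apply: ler_pM => //; [exact: ltW|rewrite subr_ge0 ltW].
have half n : 1 / 2 <= normc (\prod_(0 <= k < n) (1 - u (K + k)%N)).
  apply: le_trans (tail n).
  rewrite lerBrDr addrC -lerBrDr; apply: (@le_trans _ _ (1 / 2)); last by lra.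
  apply: le_trans KM; apply: ler_wpM2l; first by rewrite mulr_ge0 ?exprn_ge0.
  have r1' : 0 < 1 - r by rewrite subr_gt0.
  rewrite -[leRHS]mul1r ler_pdivlMr // mulrC -opprB mulNr big_mkord -subrX1 opprB.
  by rewrite gerBl exprn_ge0.
have nz k : 0 < normc (1 - u k).
  rewrite lt_neqAle normc_ge0 andbT eq_sym; apply: contra (u1 k) => /eqP/eq0_normc/eqP.
  by rewrite subr_eq0 eq_sym.
have [d0 d0_gt0 hd0] : exists2 d : R, 0 < d & forall N, (N <= K)%N ->
    d <= normc (\prod_(0 <= k < N) (1 - u k)).
  elim: (K) => [|n [d d_gt0 IHd]].
    by exists 1 => // N; rewrite leqn0 => /eqP ->; rewrite big_geq // normc1.
  exists (Num.min d (normc (\prod_(0 <= k < n.+1) (1 - u k)))).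
    rewrite lt_min d_gt0 normc_prod prodr_gt0 // => k _; exact: nz.
  move=> N; rewrite leq_eqVlt ltnS => /predU1P[->|/IHd Nd]; rewrite ge_min ?lexx ?orbT //.
  by rewrite Nd.
exists (d0 * (1 / 2)); first by rewrite mulr_gt0 ?divr_gt0.
move=> N; have [NK|/ltnW KN] := leqP N K.
  by apply: le_trans (hd0 N NK); rewrite ger_pMr // ; lra.
rewrite (big_cat_nat (n := K)) //= normcM ler_pM //; first exact: ltW.
- exact: hd0.
rewrite -{1}(add0n K) big_addn; apply: le_trans (half (N - K)%N) _.
by rewrite le_eqVlt; apply/orP; left; apply/eqP; congr normc;
  apply: eq_bigr => k _; rewrite addnC.
Qed.

(** By 1 + x <= exp x the product is at most the exponential of a geometric series. *)
Lemma prod_upper_bound u (M r : R) : 0 <= r < 1 ->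
    (forall k, normc (u k) <= M * r ^+ k) ->
  exists2 B : R, 0 < B & forall N, normc (\prod_(0 <= k < N) (1 - u k)) <= B.
Proof.
move=> r01 uM; have /andP[r0 r1] := r01.
have M0 : 0 <= M.
  by apply: le_trans (normc_ge0 (u 0%N)) _; rewrite -[leRHS]mulr1 -(expr0 r) uM.
exists (expR (M / (1 - r))) => [|N]; first exact: expR_gt0.
apply: (@le_trans _ _ (expR (\sum_(0 <= k < N) M * r ^+ k))).
  rewrite normc_prod expR_sum; apply: ler_prod => k _; rewrite normc_ge0 /=.
  apply: le_trans (expR_ge1Dx _); apply: le_trans (le_normcD _ _) _.
  by rewrite normc1 normcN lerD2l.
rewrite ler_expR -mulr_sumr; apply: ler_wpM2l => //.
have r1' : 0 < 1 - r by rewrite subr_gt0.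
rewrite -[leRHS]mul1r ler_pdivlMr // mulrC -opprB mulNr big_mkord -subrX1 opprB.
by rewrite gerBl exprn_ge0.
Qed.

End ComplexLimits.

(** * Sums over all integers *)

Section TwoSidedSums.
Variable R : realType.
Implicit Types (f g : int -> R[i]).

(** The range is -N <= k < N, which the reflection k -> -k - 1 preserves. *)
Definition zpart f (N : nat) : R[i] :=
  \sum_(0 <= k < N) f k%:Z + \sum_(0 <= k < N) f (- k.+1%:Z).

(** Split in the same way as the theta series, so that theta is an instance by unfolding. *)
Definition zsum f : R[i] :=
  limn (series (fun k : nat => f k%:Z : R[i]^o))
  + limn (series (fun k : nat => f (- k.+1%:Z) : R[i]^o)).

(** The ratio 1/2 is a convenient choice: theta terms decay faster than every geometric sequence. *)
Definition zdecay f : Prop :=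
  exists C : R, forall k, normc (f k) <= C * (1 / 2) ^+ `|k|%N.

Let half01 : 0 <= (1 / 2 : R) < 1.
Proof. by apply/andP; split; lra. Qed.

Lemma zsum_clim f : zdecay f -> clim (zpart f) (zsum f).
Proof.
case=> C fC; have C0 : 0 <= C.
  by apply: le_trans (normc_ge0 (f 0)) _; rewrite -[leRHS]mulr1 -(expr0 (1 / 2)) fC.
have [|l1 cl1] := @clim_geometric R (fun k => f k%:Z) C (1 / 2) half01.
  by move=> k; exact: fC.
have [k|l2 cl2] := @clim_geometric R (fun k => f (- k.+1%:Z)) C (1 / 2) half01.
  apply: le_trans (fC _) _; apply: ler_wpM2l => //; rewrite abszN /=.
  by rewrite exprS ler_piMl ?exprn_ge0 //; lra.
have -> : zsum f = l1 + l2 by rewrite /zsum (clim_lim cl1) (clim_lim cl2).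
exact: climD.
Qed.

Lemma zdecay_clim0 f (s : nat -> int) : zdecay f -> (forall N, (N <= `|s N|)%N) ->
  clim (fun N => f (s N)) 0.
Proof.
case=> C fC Ns; have C0 : 0 <= C.
  by apply: le_trans (normc_ge0 (f 0)) _; rewrite -[leRHS]mulr1 -(expr0 (1 / 2)) fC.
apply: (clim_le _ (cvg_geometric0 C half01)) => N; rewrite subr0.
apply: le_trans (fC _) _; apply: ler_wpM2l => //.
by apply: ler_wiXn2l => //; lra.
Qed.

Lemma zsum_unique f l : zdecay f -> clim (zpart f) l -> zsum f = l.
Proof. by move=> /zsum_clim; exact: clim_uniq. Qed.

Lemma zsumZ c f : zdecay f -> zsum (fun k => c * f k) = c * zsum f.
Proof.
move=> df; apply: zsum_unique.
  have [C fC] := df; exists (normc c * C) => k.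
  by rewrite normcM -mulrA ler_wpM2l ?normc_ge0.
have := climZ c (zsum_clim df); congr (clim _ _).
by apply/funext => N; rewrite mulrDr !mulr_sumr.
Qed.

Lemma zdecay_shift f : zdecay f -> zdecay (fun k => f (k + 1)).
Proof.
case=> C fC; exists (2 * C) => k; have C0 : 0 <= C.
  by apply: le_trans (normc_ge0 (f 0)) _; rewrite -[leRHS]mulr1 -(expr0 (1 / 2)) fC.
apply: le_trans (fC _) _; rewrite mulrAC [leRHS]mulrC ler_wpM2l //.
have : (1 / 2) ^+ (absz (k + 1)%R).+1 <= (1 / 2) ^+ absz k :> R.
  by apply: ler_wiXn2l; [lra|lra|lia].
rewrite exprS; set x := _ ^+ _; set y := _ ^+ _; lra.
Qed.

(** The shift changes the partial sum by f(N) - f(-N), which tends to 0. *)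
Lemma zsum_shift f : zdecay f -> zsum (fun k => f (k + 1)) = zsum f.
Proof.
move=> df; apply: zsum_unique; first exact: zdecay_shift.
have fN : clim (fun N => f N%:Z) 0 by apply: zdecay_clim0.
have fNN : clim (fun N => f (- N%:Z)) 0.
  by apply: zdecay_clim0 => // N; rewrite abszN.
have := climB (climD (zsum_clim df) fN) fNN; rewrite addr0 subr0.
congr (clim _ _); apply/funext => N; rewrite /zpart; elim: N => [|N IHN].
  by rewrite !big_geq // oppr0; ring.
rewrite !big_nat_recr //= in IHN *.
have -> : - N.+1%:Z + 1 = - N%:Z by lia.
have -> : N%:Z + 1 = N.+1%:Z by lia.
move: IHN; set a := \sum_(_ <= _ < _) _; set b := \sum_(_ <= _ < _) _.
set c := \sum_(_ <= _ < _) _; set d := \sum_(_ <= _ < _) _ => IHN.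
have -> : c = a + b + f N%:Z - f (- N%:Z) - d by rewrite IHN addrK.
by ring.
Qed.

Lemma zsum_reflect f : zsum (fun k => f (- k - 1)) = zsum f.
Proof.
have E1 : (fun k : nat => f (- k%:Z - 1)) = fun k => f (- k.+1%:Z).
  by apply/funext => k; congr (f _); lia.
have E2 : (fun k : nat => f (- - k.+1%:Z - 1)) = fun k => f k%:Z.
  by apply/funext => k; congr (f _); lia.
by rewrite /zsum E1 E2 addrC.
Qed.

End TwoSidedSums.

(** * Convergence, quasi-periodicity and parity of theta *)

Section ThetaSeries.
Variable R : realType.
Variables (eta : R[i]) (eta_gt0 : 0 < complex.Im eta).
Implicit Types z w : R[i].
Local Notation e := (@e2pii R).
Local Notation t := (theta_term eta).

Lemma theta_zsum z : theta eta z = zsum (t z).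
Proof. by []. Qed.

Lemma Im_realM (x : R) z : complex.Im (x%:C * z) = x * complex.Im z.
Proof. by case: z => a b /=; rewrite mul0r addr0. Qed.

Lemma normc_e2pii z : normc (e z) = expR (- (2 * pi * complex.Im z)).
Proof. by have := norm_e2pii z; move/(congr1 (@complex.Re R)). Qed.

Lemma normc_signz (k : int) : normc ((-1) ^ k : R[i]) = 1.
Proof.
have E n : normc ((-1) ^+ n : R[i]) = 1.
  by elim: n => [|n IHn]; rewrite ?normc1 // exprS normcM IHn normcN normc1 mulr1.
by case: k => n; [exact: E|rewrite NegzE -exprnN normcV E invr1].
Qed.

Lemma signz_even_shift (m n k : int) : m = n + 2 * k -> (-1 : R[i]) ^ m = (-1) ^ n.
Proof.
move=> ->; rewrite exprzDr ?unitrN1 // -exprz_exp.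
by rewrite -[(-1) ^ 2]/((-1) ^+ 2) sqrrN expr1n exp1rz mulr1.
Qed.

Lemma normc_theta_term z k : normc (t z k) =
  expR (- (2 * pi * (k%:~R * complex.Im z + (k * (k - 1))%:~R / 2 * complex.Im eta))).
Proof.
rewrite /theta_term normcM normc_signz mul1r normc_e2pii.
congr (expR (- (2 * pi * _))).
have -> : k%:~R = (k%:~R)%:C :> R[i] by rewrite rmorph_int.
have -> : (k * (k - 1))%:~R / 2 = ((k * (k - 1))%:~R / 2)%:C :> R[i].
  by rewrite fmorph_div /= rmorph_int rmorph_nat.
rewrite -(Im_realM k%:~R) -(Im_realM (_ / 2)).
by case: (_%:C * z) (_%:C * eta) => [a b] [c d].
Qed.

(** Completing the square: -A x^2 + B x is at most B^2 / (4 A), where A = pi Im eta and B also takes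
    in |ln r|. The ratio is left free because the triple product needs one smaller than |e(eta)|. *)
Lemma theta_term_bound z (r : R) : 0 < r ->
  exists C : R, forall k, normc (t z k) <= C * r ^+ `|k|%N.
Proof.
move=> r0; set y := complex.Im z; set h := complex.Im eta.
pose A := pi * h; have A0 : 0 < A by rewrite mulr_gt0 ?pi_gt0.
pose B := `|2 * pi * (y - h / 2)| + `|ln r|.
exists (expR (B ^+ 2 / (4 * A))) => k; rewrite normc_theta_term -/y -/h.
rewrite -[r in leRHS]lnK ?posrE // -expRM_natl -expRD ler_expR.
have kE : (`|k|%N%:R : R) = `|k%:~R| by rewrite natr_absz intr_norm.
rewrite kE; set x := `|k%:~R|.
have x2 : x ^+ 2 = k%:~R ^+ 2 by rewrite /x real_normK ?num_real.
have kk : (k * (k - 1))%:~R = x ^+ 2 - k%:~R :> R.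
  by rewrite x2 intrM intrB mulrBr mulr1 expr2.
have ky : - (k%:~R * (2 * pi * (y - h / 2))) <= x * `|2 * pi * (y - h / 2)|.
  by rewrite /x -normrM -normrN ler_norm.
have kr : - (x * ln r) <= x * `|ln r|.
  by rewrite -mulrN ler_wpM2l ?normr_ge0 // -normrN ler_norm.
have sq : 0 <= A * (x - B / (2 * A)) ^+ 2 by rewrite mulr_ge0 ?sqr_ge0 // ltW.
have sqE : A * (x - B / (2 * A)) ^+ 2 = A * x ^+ 2 - x * B + B ^+ 2 / (4 * A).
  by field; rewrite gt_eqF.
rewrite sqE in sq; rewrite kk.
have -> : - (2 * pi * (k%:~R * y + (x ^+ 2 - k%:~R) / 2 * h)) =
  - (A * x ^+ 2) + - (k%:~R * (2 * pi * (y - h / 2))) by rewrite /A; field.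
have xB : x * B = x * `|2 * pi * (y - h / 2)| + x * `|ln r| by rewrite /B mulrDr.
lra.
Qed.

Lemma theta_term_decay z : zdecay (t z).
Proof. by apply: theta_term_bound; lra. Qed.

Lemma thetaD1 z : theta eta (z + 1) = theta eta z.
Proof.
rewrite !theta_zsum; congr zsum; apply/funext => k; rewrite /theta_term mulrDr mulr1.
by rewrite addrAC e2piiD e2pii_int mulr1.
Qed.

Lemma theta_term_shift z k : t (z + eta) k = - e (- z) * t z (k + 1).
Proof.
rewrite /theta_term addrK exprzDr ?unitrN1 // expr1z mulrN1.
rewrite !mulNr mulrN opprK [RHS]mulrCA -e2piiD; congr (_ * e _).
by rewrite !intrM !intrB !intrD; field.
Qed.

Lemma thetaDeta z : theta eta (z + eta) = - e (- z) * theta eta z.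
Proof.
rewrite !theta_zsum -(zsum_shift (theta_term_decay z)) -zsumZ.
  by congr zsum; apply/funext => k; exact: theta_term_shift.
exact: zdecay_shift (theta_term_decay z).
Qed.

(** The substitution k -> -k - 1 turns the quadratic exponent into (k + 2)(k + 1)/2, that of the
    term of index k + 2 at z; hence the two shifts. *)
Lemma thetaN z : theta eta (- z) = - e (- z) * theta eta z.
Proof.
have d1 := zdecay_shift (theta_term_decay z).
rewrite !theta_zsum -zsum_reflect -(zsum_shift (theta_term_decay z)) -(zsum_shift d1) -zsumZ.
  congr zsum; apply/funext => k; rewrite /theta_term.
  have -> : (-1 : R[i]) ^ (- k - 1) = - (-1) ^ (k + 1 + 1).
    rewrite (@signz_even_shift (- k - 1) (k + 1) (- k - 1)); last by lia.
    by rewrite [in RHS]exprzDr ?unitrN1 // expr1z mulrN1 opprK.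
  rewrite !mulNr [in RHS]mulrCA -e2piiD; congr (- (_ * e _)).
  by rewrite !intrM !intrB !intrD !intrN; field.
exact: (zdecay_shift d1).
Qed.

Lemma theta0 : theta eta 0 = 0.
Proof.
have := thetaN 0; rewrite oppr0 e2pii0 mulN1r => /eqP.
by rewrite -addr_eq0 -mulr2n mulrn_eq0 => /eqP.
Qed.

End ThetaSeries.

(** * The triple product *)

Section GaussBinomial.
Variables (K : fieldType) (q : K).

Definition qfact (m : nat) : K := \prod_(0 <= k < m) (1 - q ^+ k.+1).

(** The Gaussian binomial coefficient through the q-Pascal rule, free of division; its expression by
    q-factorials is [gauss_qfact]. *)
Fixpoint gauss (M j : nat) : K :=
  match M, j with
  | _, 0 => 1
  | 0, _.+1 => 0
  | M'.+1, j'.+1 => gauss M' j'.+1 + q ^+ (M' - j') * gauss M' j'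
  end.

Lemma gauss_small M j : (M < j)%N -> gauss M j = 0.
Proof.
elim: M j => [|M IHM] [|j] //= lt.
by rewrite !IHM ?mulr0 ?addr0 //; lia.
Qed.

(** The q-binomial theorem. Multiplying by 1 + y q^M reproduces the q-Pascal rule because q^M = q^j
    q^(M-j) and 'C(j+1, 2) = 'C(j, 2) + j. *)
Lemma gauss_prod M (y : K) : \prod_(0 <= k < M) (1 + y * q ^+ k) =
  \sum_(0 <= j < M.+1) q ^+ 'C(j, 2) * gauss M j * y ^+ j.
Proof.
elim: M => [|M IHM].
  by rewrite big_geq // big_nat1 /= !expr0 !mulr1.
rewrite big_nat_recr //= IHM [RHS]big_nat_recl //= !expr0 !mulr1 mulrDr mulr1.
pose c j := q ^+ 'C(j, 2) * gauss M j * y ^+ j.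
have S : \sum_(0 <= j < M.+1) c j = 1 + \sum_(0 <= j < M.+1) c j.+1.
  have E : \sum_(0 <= j < M.+2) c j = \sum_(0 <= j < M.+1) c j.
    by rewrite big_nat_recr //= /c gauss_small // mulr0 mul0r addr0.
  by rewrite -E big_nat_recl //= /c; case: (M) => [|?] /=; rewrite !expr0 !mulr1.
transitivity ((1 + \sum_(0 <= j < M.+1) c j.+1) + (\sum_(0 <= j < M.+1) c j) * (y * q ^+ M)).
  by rewrite -S.
rewrite -addrA; congr (1 + _); rewrite mulr_suml -big_split /=.
apply: eq_big_nat => j /andP[_ jM]; rewrite /c mulrDr mulrDl; congr (_ + _).
rewrite binS bin1 exprD exprS.
have -> : q ^+ M = q ^+ j * q ^+ (M - j) by rewrite -exprD subnKC.
by ring.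
Qed.

(** The induction rests on 1 - q^(M+1) = (1 - q^(M-j)) + q^(M-j) (1 - q^(j+1)). *)
Lemma gauss_qfact M j : (j <= M)%N -> gauss M j * (qfact j * qfact (M - j)) = qfact M.
Proof.
have qfactS m : qfact m.+1 = qfact m * (1 - q ^+ m.+1) by rewrite /qfact big_nat_recr.
have qfact0 : qfact 0 = 1 by rewrite /qfact big_geq.
elim: M j => [|M IHM] [|j] // jM; rewrite ?qfact0 ?subn0 ?mul1r //.
rewrite subSS /= mulrDl; move: jM; rewrite ltnS leq_eqVlt => /predU1P[->|jM].
  have := IHM M (leqnn M); rewrite subnn qfact0 mulr1 => E.
  by rewrite gauss_small // mul0r add0r expr0 mul1r mulr1 qfactS mulrA E.
have MjE : qfact (M - j) = qfact (M - j.+1) * (1 - q ^+ (M - j)).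
  by rewrite -(subnSK jM) qfactS.
have IH1 := IHM _ jM; have IH2 := IHM _ (ltnW jM).
transitivity (qfact M * (1 - q ^+ (M - j)) + q ^+ (M - j) * (1 - q ^+ j.+1) * qfact M).
  congr (_ + _); first by rewrite -IH1 MjE; ring.
  by rewrite -[in RHS]IH2 qfactS; ring.
rewrite qfactS; have -> : q ^+ M.+1 = q ^+ (M - j) * q ^+ j.+1.
  by rewrite -exprD addnS subnK // ltnW.
by ring.
Qed.

End GaussBinomial.

Section ThetaProduct.
Variable R : realType.
Implicit Types z w eta : R[i].
Local Notation e := (@e2pii R).

(** The factors 1 - q^k of the triple product are left out; they return in the limit as a quotient
    of q-factorials. *)
Definition theta_prod eta z (N : nat) : R[i] :=
  \prod_(0 <= k < N) ((1 - e (z + k%:R * eta)) * (1 - e (- z + k.+1%:R * eta))).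

Lemma e2piiMnr z n : e (n%:R * z) = e z ^+ n.
Proof. by rewrite mulr_natl e2piiMn. Qed.

(* The finite form of the triple product: the q-binomial theorem [gauss_prod] for
   [2N] factors, recentred at [N]. *)
Lemma theta_prodE eta z N : theta_prod eta z N =
  \sum_(0 <= j < (N + N).+1) theta_term eta z (j%:Z - N%:Z) * gauss (e eta) (N + N) j.
Proof.
pose y := - e (z - N%:R * eta).
(* The first N factors have the form 1 - x with x = e(z - (k+1) eta); they are turned round by 1 - x
   = -x (1 - 1/x), and [denE] collects the prefactors. *)
have prodE : \prod_(0 <= k < N + N) (1 + y * e eta ^+ k) =
    \prod_(0 <= k < N) (- e (z - k.+1%:R * eta)) * theta_prod eta z N.
  have yE k : y * e eta ^+ k = - e (z + (k%:R - N%:R) * eta).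
    by rewrite /y mulNr -e2piiMnr -e2piiD; congr (- e _); ring.
  rewrite (big_cat_nat (n := N)) ?leq_addr //=.
  rewrite -{2}(add0n N) big_addn addnK big_nat_rev -!big_split /=.
  apply: eq_big_nat => k /andP[_ kN]; rewrite !yE add0n.
  have -> : (N - k.+1)%:R - N%:R = - k.+1%:R :> R[i].
    by rewrite natrB //; ring.
  have -> : (k + N)%:R - N%:R = k%:R :> R[i] by rewrite natrD; ring.
  have -> : - z + k.+1%:R * eta = - (z - k.+1%:R * eta) by ring.
  rewrite e2piiN mulNr; have := e2pii_neq0 (z - k.+1%:R * eta).
  by set a := e _ => a0; field.
have denE : \prod_(0 <= k < N) (- e (z - k.+1%:R * eta)) =
    (-1) ^+ N * e (N%:R * z - (N * N.+1)%:R / 2 * eta).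
  elim: N {prodE y} => [|N IHN].
    by rewrite big_geq // expr0 mul1r !mul0r subr0 e2pii0.
  rewrite big_nat_recr //= IHN exprSr mulrN1 mulrN mulNr.
  rewrite -[(-1) ^+ N * _ * _]mulrA -e2piiD; congr (- (_ * e _)).
  by rewrite !natrM -!natr1; field.
have den0 : (-1) ^+ N * e (N%:R * z - (N * N.+1)%:R / 2 * eta) != 0.
  by rewrite mulf_neq0 ?e2pii_neq0 // expf_neq0 // oppr_eq0 oner_neq0.
apply: (mulfI den0); rewrite -denE -prodE gauss_prod denE mulr_sumr.
apply: eq_big_nat => j _.
suff E : e eta ^+ 'C(j, 2) * y ^+ j =
    (-1) ^+ N * e (N%:R * z - (N * N.+1)%:R / 2 * eta) * theta_term eta z (j%:Z - N%:Z).
  by rewrite mulrAC E -[LHS]mulrA.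
rewrite /theta_term /y.
have -> : (-1 : R[i]) ^ (j%:Z - N%:Z) = (-1) ^+ N * (-1) ^+ j.
  rewrite (@signz_even_shift R (j%:Z - N%:Z) (N%:Z + j%:Z) (- N%:Z)); last by lia.
  by rewrite exprzDr ?unitrN1.
transitivity ((-1) ^+ j * e ('C(j, 2)%:R * eta + j%:R * (z - N%:R * eta))).
  by rewrite [in RHS]e2piiD !e2piiMnr [in LHS]exprNn; ring.
have comb (s u a b : R[i]) : s * a * (s * u * b) = s ^+ 2 * (u * (a * b)) by ring.
rewrite comb sqrr_sign mul1r -e2piiD; congr (_ * e _).
have -> : 'C(j, 2)%:R = j%:R * (j%:R - 1) / 2 :> R[i].
  case: j => [|j]; first by rewrite bin0n !mul0r.
  have := mul_bin_diag j.+1 1; rewrite /= bin1 => E.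
  apply: (mulfI (_ : 2%:R != 0)); rewrite ?pnatr_eq0 // -natrM -E natrM.
  by rewrite -(natr1 j); field.
by rewrite natrM -natr1 !intrM !intrB; field.
Qed.

End ThetaProduct.

Lemma sum_int_centered (V : zmodType) (f : int -> V) N :
  \sum_(0 <= j < (N + N).+1) f (j%:Z - N%:Z) =
    \sum_(0 <= k < N) f k%:Z + \sum_(0 <= k < N) f (- k.+1%:Z) + f N%:Z.
Proof.
rewrite (big_cat_nat (n := N)) //=; last by rewrite -addnS leq_addr.
rewrite addrAC addrC; congr (_ + _).
  rewrite -{1}(add0n N) big_addn -addnS addKn big_nat_recr //=.
  by congr (_ + _); [apply: eq_big_nat => k _|]; congr (f _); lia.
by rewrite big_nat_rev; apply: eq_big_nat => k /andP[_ kN]; congr (f _); lia.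
Qed.

Section ThetaProductLimit.
Variable R : realType.
Variables (eta : R[i]) (eta_gt0 : 0 < complex.Im eta).
Implicit Types z w : R[i].
Local Notation e := (@e2pii R).
Local Notation q := (e eta).
Local Notation rho := (normc q).

Lemma rho_itv : 0 < rho < 1.
Proof.
rewrite normc_e2pii expR_gt0 expR_lt1 oppr_lt0 /=.
by rewrite !mulr_gt0 ?pi_gt0.
Qed.

Let rho01 : 0 <= rho < 1.
Proof. by have /andP[/ltW -> ->] := rho_itv. Qed.

Let rho_gt0 : 0 < rho. Proof. by case/andP: rho_itv. Qed.
Let rho_lt1 : rho < 1. Proof. by case/andP: rho_itv. Qed.

Lemma normcX z n : normc (z ^+ n) = normc z ^+ n.
Proof. by elim: n => [|n IHn]; rewrite ?normc1 // !exprS normcM IHn. Qed.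

Let q_le k : normc (q ^+ k.+1) <= 1 * rho ^+ k.
Proof. by rewrite normcX mul1r exprS ler_piMl ?exprn_ge0 ?ltW. Qed.

Lemma qfact_lower : exists2 d : R, 0 < d & forall N, d <= normc (qfact q N).
Proof.
apply: (prod_lower_bound rho01 q_le) => k; apply/eqP => /(congr1 (@normc R)).
by rewrite normcX normc1 => /eqP; rewrite lt_eqF // exprn_ilt1 // ltW.
Qed.

Lemma qfact_upper : exists2 B : R, 0 < B & forall N, normc (qfact q N) <= B.
Proof. exact: (prod_upper_bound rho01 q_le). Qed.

Lemma qfact_neq0 N : qfact q N != 0.
Proof.
have [d d0 dE] := qfact_lower; apply: contraTneq (dE N) => ->.
by rewrite normc0 -ltNge.
Qed.

Lemma qfact_diff : exists2 B : R, 0 <= B &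
  forall a n, normc (qfact q (a + n) - qfact q a) <= B * rho ^+ a.
Proof.
have [B B0 EB] := qfact_upper; have r1 : 0 < 1 - rho by rewrite subr_gt0.
exists (B / (1 - rho)) => [|a n]; first by rewrite divr_ge0 ?ltW.
(* With the extra factor 1 - rho^n the bound is an exact geometric partial sum, so that the
   induction closes. *)
have : normc (qfact q (a + n) - qfact q a) <= B / (1 - rho) * rho ^+ a * (1 - rho ^+ n).
  elim: n => [|n IHn]; first by rewrite addn0 subrr normc0 expr0 subrr mulr0.
  rewrite addnS; set x := qfact q a.
  have -> : qfact q (a + n).+1 = qfact q (a + n) * (1 - q ^+ (a + n).+1).
    by rewrite /qfact big_nat_recr.
  have -> : qfact q (a + n) * (1 - q ^+ (a + n).+1) - x =
    (qfact q (a + n) - x) - qfact q (a + n) * q ^+ (a + n).+1 by ring.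
  apply: le_trans (le_normcD _ _) _; rewrite normcN normcM.
  apply: le_trans (lerD IHn (ler_pM (normc_ge0 _) (normc_ge0 _) (EB _) (q_le _))) _.
  rewrite mul1r exprD exprS le_eqVlt; apply/orP; left; apply/eqP.
  by field; rewrite subr_eq0 eq_sym lt_eqF.
move/le_trans; apply; rewrite ler_piMr //.
  by rewrite mulr_ge0 ?divr_ge0 ?exprn_ge0 ?ltW.
by rewrite gerBl exprn_ge0 // ltW.
Qed.

Lemma sum_half_centered N :
  \sum_(0 <= j < (N + N).+1) (1 / 2) ^+ `|j%:Z - N%:Z|%N <= 4 :> R.
Proof.
rewrite (sum_int_centered (fun k : int => (1 / 2) ^+ `|k|%N : R)) /=.
have geo n : \sum_(0 <= k < n) (1 / 2) ^+ k = 2 - 2 * (1 / 2) ^+ n :> R.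
  elim: n => [|n IHn]; first by rewrite big_geq // expr0; lra.
  by rewrite big_nat_recr //= IHn exprS; lra.
under [X in _ + X + _]eq_bigr do rewrite exprS.
rewrite -mulr_sumr geo.
have : 0 <= (1 / 2 : R) ^+ N by apply: exprn_ge0; lra.
by lra.
Qed.

(** By [theta_prodE] the sequence is the centred partial sum with its term of index k = j - N
    weighted by qfact(N)^2 / (qfact(j) qfact(2N - j)). This weight is close to 1 only for j near N:
    it deviates by O(rho^(N - |k|)). Bounding the terms by (rho/2)^|k|, the part rho^|k| compensates
    this and leaves rho^N, while the part 2^-|k| remains summable. *)
Lemma theta_prod_clim z :
  clim (fun N => qfact q N ^+ 2 / qfact q (N + N) * theta_prod eta z N) (theta eta z).
Proof.
have dec := theta_term_decay eta_gt0 z.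
have fN : clim (fun N => theta_term eta z N%:Z) 0 by apply: zdecay_clim0.
have U := climD (zsum_clim dec) fN; rewrite addr0 in U.
apply: (clim_sub U).
have [d d0 dE] := qfact_lower; have [B B0 EB] := qfact_upper.
have [B' B'0 EB'] := qfact_diff.
have [C tC] : exists C : R, forall k,
    normc (theta_term eta z k) <= C * (rho * (1 / 2)) ^+ `|k|%N.
  by apply: theta_term_bound => //; rewrite mulr_gt0.
have C0 : 0 <= C.
  apply: le_trans (normc_ge0 (theta_term eta z 0)) _.
  by rewrite -[leRHS]mulr1 -(expr0 (rho * (1 / 2))) tC.
pose D := 4 * B * B' / d ^+ 2; have D0 : 0 <= D.
  by apply: divr_ge0; [rewrite !mulr_ge0 // ltW|rewrite exprn_ge0 // ltW].
have ratio N j : (j <= N + N)%N ->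
    normc (1 - qfact q N ^+ 2 / qfact q (N + N) * gauss q (N + N) j) * rho ^+ `|j%:Z - N%:Z|%N
      <= D * rho ^+ N.
  move=> jN; set g := gauss _ _ _; have gE := gauss_qfact q jN; rewrite -/g in gE.
  set a := qfact q j in gE *; set b := qfact q (N + N - j) in gE.
  have a0 : a != 0 by exact: qfact_neq0.
  have b0 : b != 0 by exact: qfact_neq0.
  have -> : 1 - qfact q N ^+ 2 / qfact q (N + N) * g = (a * b - qfact q N ^+ 2) / (a * b).
    have E0 := qfact_neq0 (N + N).
    have -> : g = qfact q (N + N) / (a * b) by rewrite -gE mulfK // mulf_neq0.
    by field; rewrite E0 a0 b0.
  rewrite normcM normcV normcM.
  have abd : (normc a * normc b)^-1 <= (d ^+ 2)^-1.
    have ad : 0 < normc a := lt_le_trans d0 (dE _).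
    have bd : 0 < normc b := lt_le_trans d0 (dE _).
    rewrite lef_pV2 ?posrE ?mulr_gt0 ?exprn_gt0 // expr2.
    by apply: ler_pM; [exact: ltW|exact: ltW|exact: dE|exact: dE].
  set m := minn j (N + N - j); have jm : (m + `|j%:Z - N%:Z|%N = N)%N.
    rewrite /m; have [jN'|/ltnW Nj] := leqP j N.
      by rewrite distnEr // (minn_idPl _) ?subnKC //; clear -jN jN'; lia.
    by rewrite distnEl // (minn_idPr _); clear -jN Nj; lia.
  have mN : (m <= N)%N by rewrite -jm leq_addr.
  have near_N i : (m <= i)%N ->
      normc (qfact q i - qfact q N) <= 2 * (B' * rho ^+ m).
    move=> mi; have -> : qfact q i - qfact q N =
      (qfact q i - qfact q m) - (qfact q N - qfact q m) by ring.
    apply: le_trans (le_normcD _ _) _; rewrite normcN.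
    have := EB' m (i - m)%N; have := EB' m (N - m)%N; rewrite !subnKC //; lra.
  have num : normc (a * b - qfact q N ^+ 2) <= 4 * B * B' * rho ^+ m.
    have -> : a * b - qfact q N ^+ 2 = a * (b - qfact q N) + (a - qfact q N) * qfact q N.
      by ring.
    apply: le_trans (le_normcD _ _) _; rewrite (normcM a) (normcM (a - _)).
    have na : normc a <= B := EB _.
    have nN : normc (qfact q N) <= B := EB _.
    have ea : normc (a - qfact q N) <= 2 * (B' * rho ^+ m) by apply: near_N; exact: geq_minl.
    have eb : normc (b - qfact q N) <= 2 * (B' * rho ^+ m) by apply: near_N; exact: geq_minr.
    have -> : 4 * B * B' * rho ^+ m = B * (2 * (B' * rho ^+ m)) + 2 * (B' * rho ^+ m) * B.
      by ring.
    by apply: lerD; apply: ler_pM => //; exact: normc_ge0.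
  have -> : rho ^+ N = rho ^+ m * rho ^+ `|j%:Z - N%:Z|%N by rewrite -exprD jm.
  rewrite mulrA ler_wpM2r ?exprn_ge0 ?(ltW rho_gt0) //.
  apply: le_trans (ler_pM (normc_ge0 _) _ num abd) _.
    by rewrite invr_ge0 mulr_ge0 ?normc_ge0.
  by rewrite /D le_eqVlt; apply/orP; left; apply/eqP; ring.
apply: (clim_le _ (cvg_geometric0 (D * C * 4) rho01)) => N; rewrite subr0.
rewrite -sum_int_centered theta_prodE mulr_sumr -sumrB.
apply: le_trans (normc_sum _ _) _.
apply: (@le_trans _ _ (\sum_(0 <= j < (N + N).+1)
    D * rho ^+ N * C * (1 / 2) ^+ `|j%:Z - N%:Z|%N)); last first.
  rewrite -mulr_sumr; have -> : D * C * 4 * rho ^+ N = D * rho ^+ N * C * 4 by ring.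
  apply: ler_wpM2l; last exact: sum_half_centered.
  apply: mulr_ge0 => //; apply: mulr_ge0 => //; exact: exprn_ge0 (ltW rho_gt0).
rewrite big_seq_cond [leRHS]big_seq_cond; apply: ler_sum => j.
rewrite mem_index_iota andbT => /andP[_]; rewrite ltnS => jN.
set k := j%:Z - N%:Z.
have -> : theta_term eta z k - qfact q N ^+ 2 / qfact q (N + N) *
    (theta_term eta z k * gauss q (N + N) j) =
    (1 - qfact q N ^+ 2 / qfact q (N + N) * gauss q (N + N) j) * theta_term eta z k.
  by ring.
rewrite normcM; apply: le_trans (ler_wpM2l (normc_ge0 _) (tC k)) _.
rewrite exprMn; set x := normc _; set r := rho ^+ `|k|%N; set h := _ ^+ `|k|%N.
have -> : x * (C * (r * h)) = (x * r) * (C * h) by ring.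
have -> : D * rho ^+ N * C * h = (D * rho ^+ N) * (C * h) by ring.
apply: ler_wpM2r; last exact: ratio.
by apply: mulr_ge0 => //; apply: exprn_ge0; lra.
Qed.

Lemma clim_lower_neq0 (u : nat -> R[i]) l (d : R) :
  0 < d -> (forall N, d <= normc (u N)) -> clim u l -> l != 0.
Proof.
move=> d0 du ul; apply/eqP => l0; move: ul; rewrite l0 /clim.
move/cvgrPdist_lt => /(_ d d0)[N _ /(_ N (leqnn N))].
rewrite sub0r normrN subr0 ger0_norm ?normc_ge0 //.
by rewrite ltNge du.
Qed.

(** A factor vanishes only if z is in the lattice. Since nonzero factors alone do not exclude the
    limit 0, each of the two half products and the q-factorials are bounded uniformly. *)
Lemma theta_neq0 z : ~ lattice eta z -> theta eta z != 0.
Proof.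
move=> zL; have [d d0 dE] := qfact_lower; have [B B0 EB] := qfact_upper.
have norm_e w k : normc (e (w + k%:R * eta)) = normc (e w) * rho ^+ k.
  by rewrite e2piiD e2piiMnr normcM normcX.
have [] := @prod_lower_bound R (fun k => e (z + k%:R * eta)) (normc (e z)) rho rho01.
- by move=> k; rewrite norm_e.
- move=> k; apply/eqP => /e2pii_eq1[m mE]; apply: zL; exists m, (- k%:Z).
  by rewrite -mE mulrNz mulNr addrK.
move=> d1 d1_gt0 hd1.
have [] := @prod_lower_bound R (fun k => e (- z + k.+1%:R * eta)) (normc (e (- z))) rho rho01.
- move=> k; rewrite norm_e; apply: ler_wpM2l; first exact: normc_ge0.
  by rewrite exprS ler_piMl ?exprn_ge0 ?(ltW rho_gt0) ?(ltW rho_lt1).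
- move=> k; apply/eqP => /e2pii_eq1[m mE]; apply: zL; exists (- m), k.+1%:Z.
  by rewrite mulrNz -mE -[k.+1%:Z%:~R]/(k.+1%:R) opprD opprK addrNK.
move=> d2 d2_gt0 hd2.
apply: (clim_lower_neq0 (d := d ^+ 2 / B * (d1 * d2)) _ _ (theta_prod_clim z)).
  by rewrite mulr_gt0 ?divr_gt0 ?exprn_gt0 ?mulr_gt0.
move=> N; rewrite (normcM (_ / _)) /theta_prod big_split /= (normcM (\prod_(_ <= _ < _) _)).
have le1 : d ^+ 2 / B <= normc (qfact q N ^+ 2 / qfact q (N + N)).
  rewrite (normcM (_ ^+ 2)) normcV normcX; apply: ler_pM.
  - by rewrite exprn_ge0 ?ltW.
  - by rewrite invr_ge0 ltW.
  - by apply: lerXn2r; rewrite ?nnegrE ?normc_ge0 ?(ltW d0) ?dE.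
  by rewrite lef_pV2 ?posrE // (lt_le_trans d0 (dE _)).
apply: ler_pM => //.
- by rewrite ltW // divr_gt0 ?exprn_gt0.
- by rewrite ltW // mulr_gt0.
by apply: ler_pM; [exact: ltW|exact: ltW|exact: hd1|exact: hd2].
Qed.

End ThetaProductLimit.

(** * Products over shifts by m/n and the modulus n eta *)

Section ThetaIsogeny.
Variable R : realType.
Implicit Types z w eta : R[i].
Local Notation e := (@e2pii R).

(** The signs s = 1 and s = -1 serve the two halves of the theta product, in which z enters with
    opposite signs. *)
Lemma e2pii_prim (n : nat) (s : R[i]) : (0 < n)%N -> s ^+ 2 = 1 ->
  n.-primitive_root (e (s / n%:R)).
Proof.
move=> n0 s2; have nz : n%:R != 0 :> R[i] by rewrite pnatr_eq0 -lt0n.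
have s_int : exists k : int, s = k%:~R.
  move/eqP: s2; rewrite sqrf_eq1 => /orP[]/eqP ->; first by exists 1.
  by exists (-1); rewrite mulrNz.
have en : e (s / n%:R) ^+ n = 1.
  have [k ->] := s_int.
  by rewrite -e2piiMn -[_ *+ n in LHS](mulr_natr (_ / _)) divfK // e2pii_int.
have [m pm mn] := prim_order_exists n0 en.
suff nm : (n %| m)%N.
  have mnE : m = n by apply/eqP; rewrite eqn_dvd mn nm.
  by move: pm; rewrite mnE.
have : e (s / n%:R *+ m) = 1 by rewrite e2piiMn prim_expr_order.
move=> /e2pii_eq1[k kE].
have mk : m%:R = s * k%:~R * n%:R :> R[i].
  by rewrite -kE -(mulr_natr (_ / _)) !mulrA -expr2 s2 mul1r mulrAC mulVf ?mul1r.
have [l lE] := s_int; move: mk; rewrite lE -intrM -[n%:R]/(n%:Z%:~R) -intrM.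
rewrite -[m%:R]/(m%:Z%:~R) => /intr_inj mk.
by have := dvdz_mull (l * k) (dvdzz n%:Z); rewrite -mk.
Qed.

(** The factorisation of X^n - 1, evaluated at 1/x and multiplied by x^n. *)
Lemma prod_unity_root (n : nat) (z x : R[i]) : n.-primitive_root z -> x != 0 ->
  \prod_(m < n) (1 - z ^+ m * x) = 1 - x ^+ n.
Proof.
move=> pz x0; have := factor_Xn_sub_1 pz; rewrite big_mkord.
move/(congr1 (fun P : {poly R[i]} => x ^+ n * P.[x^-1])).
have -> : ('X^n - 1 : {poly R[i]}).[x^-1] = x^-1 ^+ n - 1 by rewrite !hornerE.
rewrite horner_prod mulrBr -exprMn divff // expr1n mulr1 => <-.
rewrite -[in x ^+ n](card_ord n) -prodr_const -big_split /=; apply: eq_bigr => m _.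
by rewrite hornerXsubC mulrBr divff // mulrC.
Qed.

Lemma theta_prod_isogeny eta z (n N : nat) : (0 < n)%N ->
  \prod_(m < n) theta_prod eta (z + m%:R / n%:R) N = theta_prod (n%:R * eta) (n%:R * z) N.
Proof.
move=> n0; rewrite /theta_prod exchange_big /=; apply: eq_bigr => k _.
rewrite big_split /=; congr (_ * _).
  have -> : n%:R * z + k%:R * (n%:R * eta) = n%:R * (z + k%:R * eta) by ring.
  rewrite e2piiMnr -(prod_unity_root (e2pii_prim n0 (expr1n _ 2))) ?e2pii_neq0 //.
  apply: eq_bigr => m _; rewrite -e2piiMn -e2piiD; congr (1 - e _).
  by rewrite -(mulr_natr (_ / _)); ring.
have -> : - (n%:R * z) + k.+1%:R * (n%:R * eta) = n%:R * (- z + k.+1%:R * eta) by ring.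
have s2 : (-1 : R[i]) ^+ 2 = 1 by rewrite sqrrN expr1n.
rewrite e2piiMnr -(prod_unity_root (e2pii_prim n0 s2)) ?e2pii_neq0 //.
apply: eq_bigr => m _; rewrite -e2piiMn -e2piiD; congr (1 - e _).
by rewrite -(mulr_natr (_ / _)); ring.
Qed.

(* Comparing two values [z] and [z0] avoids computing the constant factor. *)
Lemma theta_isogeny eta z z0 (n : nat) : 0 < complex.Im eta -> (0 < n)%N ->
  (\prod_(m < n) theta eta (z + m%:R / n%:R)) * theta (n%:R * eta) (n%:R * z0) =
  theta (n%:R * eta) (n%:R * z) * \prod_(m < n) theta eta (z0 + m%:R / n%:R).
Proof.
move=> eta_gt0 n0.
have neta_gt0 : 0 < complex.Im (n%:R * eta).
  rewrite mulr_natl raddfMn /= pmulrn_rgt0 //.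
pose u eta N : R[i] := qfact (e eta) N ^+ 2 / qfact (e eta) (N + N).
have lim_prod w : clim (fun N => u eta N ^+ n * theta_prod (n%:R * eta) (n%:R * w) N)
    (\prod_(m < n) theta eta (w + m%:R / n%:R)).
  have := clim_prod (fun m : 'I_n => theta_prod_clim eta_gt0 (w + m%:R / n%:R)).
  congr (clim _ _); apply/funext => N; rewrite big_split /= prodr_const card_ord.
  by rewrite theta_prod_isogeny.
have lim_n w := theta_prod_clim neta_gt0 (n%:R * w).
apply: clim_uniq (climM (lim_prod z) (lim_n z0)) _.
have := climM (lim_n z) (lim_prod z0); congr (clim _ _); apply/funext => N.
by rewrite mulrACA [in RHS]mulrACA [X in X * _ = _]mulrC.
Qed.

End ThetaIsogeny.

(** * The addition formula *)

Section AbsoluteSums.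
Variables (R : realType) (T : eqType).
Implicit Types (s u b : seq T) (g : T -> R[i]).

Lemma sum_uniq_sub (V : zmodType) (h : T -> V) s u : uniq s -> uniq u -> {subset s <= u} ->
  \sum_(x <- u) h x = \sum_(x <- s) h x + \sum_(x <- u | x \notin s) h x.
Proof.
move=> us uu su; rewrite (bigID (mem s)) /=; congr (_ + _).
rewrite -big_filter; apply: perm_big; apply: uniq_perm; rewrite ?filter_uniq //.
by move=> x; rewrite mem_filter /=; case xs: (x \in s) => //=; rewrite su.
Qed.

(** An irregular index set [u] is controlled by two regular ones that enclose it, through the
    absolute sums over these. *)
Lemma normc_sum_diff g s u b : uniq s -> uniq u -> uniq b ->
    {subset s <= u} -> {subset u <= b} ->
  normc (\sum_(x <- u) g x - \sum_(x <- s) g x)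
    <= \sum_(x <- b) normc (g x) - \sum_(x <- s) normc (g x).
Proof.
move=> us uu ub su subu.
rewrite (sum_uniq_sub g us uu su) addrAC subrr add0r.
rewrite (sum_uniq_sub (fun x => normc (g x)) us ub (fun x xs => subu x (su x xs))).
rewrite addrAC subrr add0r -big_filter; apply: le_trans (normc_sum _ _) _.
rewrite -[leRHS]big_filter.
rewrite (@sum_uniq_sub R (fun x => normc (g x))
  [seq x <- u | x \notin s] [seq x <- b | x \notin s]).
- by rewrite lerDl; apply: sumr_ge0 => x _; exact: normc_ge0.
- by rewrite filter_uniq.
- by rewrite filter_uniq.
by move=> x; rewrite !mem_filter => /andP[-> /subu].
Qed.

End AbsoluteSums.

Section IntBoxes.

Definition int_range (N : nat) : seq int := [seq k%:Z - N%:Z | k <- iota 0 (N + N).+1].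

Lemma mem_int_range N k : (k \in int_range N) = (- N%:Z <= k <= N%:Z).
Proof.
apply/mapP/andP => [[j]|[lo hi]]; first by rewrite mem_iota => jN ->; split; lia.
by exists (absz (k + N%:Z)%R); [rewrite mem_iota|]; lia.
Qed.

Lemma int_range_uniq N : uniq (int_range N).
Proof. by rewrite map_inj_uniq ?iota_uniq // => i j; lia. Qed.

Definition int_box N : seq (int * int) := [seq (k, l) | k <- int_range N, l <- int_range N].

Lemma mem_int_box N k l :
  ((k, l) \in int_box N) = (k \in int_range N) && (l \in int_range N).
Proof.
apply/allpairsP/andP => [[[i j] /= [iN jN [-> ->]]]//|[kN lN]].
by exists (k, l).
Qed.

Lemma int_box_uniq N : uniq (int_box N).
Proof.
by apply: allpairs_uniq; rewrite ?int_range_uniq // => [[i j] [k l]] _ _ [-> ->].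
Qed.

Lemma sum_int_range (V : zmodType) (f : int -> V) N : \sum_(k <- int_range N) f k =
  \sum_(0 <= k < N) f k%:Z + \sum_(0 <= k < N) f (- k.+1%:Z) + f N%:Z.
Proof. by rewrite -sum_int_centered /int_range big_map /index_iota subn0. Qed.

Lemma sum_int_box (K : pzSemiRingType) (f g : int -> K) N :
  \sum_(x <- int_box N) f x.1 * g x.2 =
    (\sum_(k <- int_range N) f k) * (\sum_(l <- int_range N) g l).
Proof. by rewrite big_allpairs big_distrlr. Qed.

(** Index pairs (k, l) with k + l even, then odd. In the coordinates i, j the exponent k(k-1)/2 +
    l(l-1)/2 separates into a function of i and a function of j. *)
Definition parity_box N : seq (int * int) :=
  [seq (x.1 + x.2, x.1 - x.2) | x <- int_box N]
    ++ [seq (x.1 + x.2 + 1, x.1 - x.2) | x <- int_box N].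

Lemma parity_box_uniq N : uniq (parity_box N).
Proof.
rewrite cat_uniq; apply/and3P; split.
- rewrite map_inj_uniq ?int_box_uniq // => -[i j] [k l] /= [E1 E2].
  by congr (_, _); lia.
- apply/hasPn => _ /mapP[[i j] _ ->]; apply/mapP => -[[k l] _] /= [E1 E2]; lia.
- rewrite map_inj_uniq ?int_box_uniq // => -[i j] [k l] /= [E1 E2].
  by congr (_, _); lia.
Qed.

Lemma int_box_parity N : {subset int_box N <= parity_box N.+1}.
Proof.
move=> [k l]; rewrite mem_int_box !mem_int_range mem_cat => /andP[/andP[k1 k2] /andP[l1 l2]].
have [i [iE|iE]] : exists i : int, k + l = 2 * i \/ k + l = 2 * i + 1.
  by exists ((k + l) %/ 2)%Z; lia.
  apply/orP; left; apply/mapP; exists (i, k - i) => /=.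
    by rewrite mem_int_box !mem_int_range; lia.
  by congr (_, _); lia.
apply/orP; right; apply/mapP; exists (i, k - i - 1) => /=.
  by rewrite mem_int_box !mem_int_range; lia.
by congr (_, _); lia.
Qed.

Lemma parity_box_sub N : {subset parity_box N <= int_box (N + N).+1}.
Proof.
move=> x; rewrite mem_cat => /orP[]/mapP[[i j]]; rewrite mem_int_box !mem_int_range => ij ->;
  by rewrite mem_int_box !mem_int_range /=; lia.
Qed.

End IntBoxes.

Section ThetaAddition.
Variable R : realType.
Local Notation e := (@e2pii R).

Lemma int_range_clim (f : int -> R[i]) : zdecay f ->
  clim (fun N => \sum_(k <- int_range N) f k) (zsum f).
Proof.
move=> df; have fN : clim (fun N => f N%:Z) 0 by apply: zdecay_clim0.
have := climD (zsum_clim df) fN; rewrite addr0; congr (clim _ _).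
by apply/funext => N; rewrite sum_int_range.
Qed.

Lemma normc_real (x : R) : normc x%:C = `|x|.
Proof. by rewrite /= expr0n addr0 sqrtr_sqr. Qed.

(* The parity box [N.+1] lies between the square boxes [N] and [2N + 3], so that
   the two ways of exhausting the double series have the same limit. *)
Lemma double_sum_parity (F G : int -> R[i]) l : zdecay F -> zdecay G ->
  clim (fun N => \sum_(x <- parity_box N) F x.1 * G x.2) l ->
  zsum F * zsum G = l.
Proof.
move=> dF dG ul; pose A k := (normc (F k))%:C; pose B k := (normc (G k))%:C.
have dec f : zdecay f -> zdecay (fun k => (normc (f k))%:C : R[i]).
  by case=> C fC; exists C => k; rewrite normc_real ger0_norm ?normc_ge0.
have boxl := climM (int_range_clim dF) (int_range_clim dG).
have absl := climM (int_range_clim (dec _ dF)) (int_range_clim (dec _ dG)).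
have shift3 N : (N <= (N.+1 + N.+1).+1)%N by lia.
have diff0 := climB (clim_comp shift3 absl) absl; rewrite subrr in diff0.
have shift1 N : (N <= N.+1)%N by [].
apply: clim_uniq (_ : clim _ _) (clim_comp shift1 ul).
apply: (clim_sub boxl).
apply: (clim_le _ diff0) => N; rewrite subr0 /=.
rewrite -opprB normcN.
have -> : (\sum_(k <- int_range N) F k) * (\sum_(k <- int_range N) G k) =
    \sum_(x <- int_box N) F x.1 * G x.2 by rewrite sum_int_box.
apply: le_trans (normc_sum_diff _ (int_box_uniq N) (parity_box_uniq N.+1)
  (int_box_uniq _) (@int_box_parity N) (@parity_box_sub N.+1)) _.
have absE M : \sum_(x <- int_box M) normc (F x.1 * G x.2) =
    (\sum_(k <- int_range M) normc (F k)) * (\sum_(k <- int_range M) normc (G k)).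
  by rewrite -sum_int_box; apply: eq_bigr => x _; rewrite normcM.
rewrite !absE.
have castE M : (\sum_(k <- int_range M) A k) * (\sum_(k <- int_range M) B k) =
    ((\sum_(k <- int_range M) normc (F k)) * (\sum_(k <- int_range M) normc (G k)))%:C.
  by rewrite rmorphM !rmorph_sum.
have subC (a b : R) : a%:C - b%:C = (a - b)%:C by rewrite rmorphB.
by rewrite !castE subC subr0 normc_real; exact: ler_norm.
Qed.

Variables (eta : R[i]) (eta_gt0 : 0 < complex.Im eta).
Implicit Types z w : R[i].

Let eta2_gt0 : 0 < complex.Im (2 * eta).
Proof. by rewrite mulr_natl raddfMn /= pmulrn_rgt0. Qed.

Let half_int (k : int) : e (k%:~R * (1 / 2)) = (-1) ^ k.
Proof.
have E n : e (n%:R * (1 / 2)) = (-1) ^+ n by rewrite e2piiMnr e2pii_half.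
case: k => n; first exact: E.
by rewrite NegzE mulrNz mulNr e2piiN [e _]E -exprnN.
Qed.

Let signz_sqr (k : int) : (-1 : R[i]) ^ k * (-1) ^ k = 1.
Proof.
rewrite -exprzDr ?unitrN1 // (@signz_even_shift R (k + k) 0 k) ?expr0z //.
by lia.
Qed.

(** The shift by 1/2 cancels the alternating sign, as needed on the right of the addition formula,
    where signs have multiplied to a constant. *)
Let theta_term_half y k :
  theta_term (2 * eta) (y + 1 / 2) k = e (k%:~R * y + (k * (k - 1))%:~R * eta).
Proof.
rewrite /theta_term; set c := _ / 2 * _.
have -> : k%:~R * (y + 1 / 2) + c = (k%:~R * y + c) + k%:~R * (1 / 2) by ring.
rewrite e2piiD half_int mulrCA signz_sqr mulr1 /c; congr e.
by field.
Qed.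

(** At (i + j, i - j) the quadratic exponents add up to i(i-1) + j(j-1) + j; the last j is the shift
    of 2w by eta. *)
Lemma theta_term_even z w i j :
  theta_term eta (z + w) (i + j) * theta_term eta (z - w) (i - j) =
  theta_term (2 * eta) (2 * z + 1 / 2) i * theta_term (2 * eta) (2 * w + eta + 1 / 2) j.
Proof.
rewrite !theta_term_half /theta_term mulrACA.
rewrite (@signz_even_shift R (i - j) (i + j) (- j)); last by lia.
rewrite signz_sqr mul1r -!e2piiD; congr e.
by rewrite !(intrM, intrD, intrN); field.
Qed.

Lemma theta_term_odd z w i j :
  theta_term eta (z + w) (i + j + 1) * theta_term eta (z - w) (i - j) =
  - e (z + w) * theta_term (2 * eta) (2 * z + eta + 1 / 2) i
    * theta_term (2 * eta) (2 * w + 2 * eta + 1 / 2) j.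
Proof.
rewrite !theta_term_half /theta_term mulrACA.
rewrite (@signz_even_shift R (i - j) (i + j) (- j)); last by lia.
rewrite exprzDr ?unitrN1 // expr1z mulrN1 mulNr signz_sqr mulN1r 2!mulNr.
rewrite -!e2piiD; congr (- e _).
by rewrite !(intrM, intrD, intrN); field.
Qed.

Lemma theta_addition z w :
  theta eta (z + w) * theta eta (z - w) =
  theta (2 * eta) (2 * z + 1 / 2) * theta (2 * eta) (2 * w + eta + 1 / 2)
  - e (z + w) * theta (2 * eta) (2 * z + eta + 1 / 2)
      * theta (2 * eta) (2 * w + 2 * eta + 1 / 2).
Proof.
apply: double_sum_parity; try exact: theta_term_decay.
have L y := int_range_clim (theta_term_decay eta2_gt0 y).
have := climB (climM (L (2 * z + 1 / 2)) (L (2 * w + eta + 1 / 2)))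
  (climM (climZ (e (z + w)) (L (2 * z + eta + 1 / 2))) (L (2 * w + 2 * eta + 1 / 2))).
congr (clim _ _); apply/funext => N.
rewrite /parity_box big_cat [in RHS]big_map [in RHS]big_map; congr (_ + _).
  by rewrite -sum_int_box; apply: eq_bigr => -[i j] _; exact: esym (theta_term_even _ _ _ _).
rewrite -mulrA -sum_int_box mulr_sumr -sumrN; apply: eq_bigr => -[i j] _ /=.
by rewrite (theta_term_odd z w i j) !mulNr mulrA.
Qed.

End ThetaAddition.

(** * Theta functions of order n *)

Section Lattice.
Variable R : realType.
Implicit Types z w eta : R[i].

Lemma latticeD eta z w : lattice eta z -> lattice eta w -> lattice eta (z + w).
Proof.
move=> [a [b ->]] [c [d ->]]; exists (a + c), (b + d).
by rewrite !intrD; ring.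
Qed.

Lemma latticeN eta z : lattice eta z -> lattice eta (- z).
Proof. by move=> [a [b ->]]; exists (- a), (- b); rewrite !intrN; ring. Qed.

Lemma latticeMn eta z n : lattice eta z -> lattice eta (z *+ n).
Proof.
move=> zL; elim: n => [|n IHn]; last by rewrite mulrS; exact: latticeD.
by exists 0, 0; rewrite mul0r addr0.
Qed.

Lemma lattice_eta eta (k : int) : lattice eta (k%:~R * eta).
Proof. by exists 0, k; rewrite add0r. Qed.

Lemma lattice_muln eta z (n : nat) : lattice (n%:R * eta) z -> lattice eta z.
Proof.
move=> [a [b ->]]; exists a, (b * n%:Z); rewrite intrM.
by rewrite -[n%:Z%:~R]/(n%:R); ring.
Qed.

Lemma lattice_int_eta eta (n : nat) (k : int) : 0 < complex.Im eta ->
  lattice (n%:R * eta) (k%:~R * eta) -> (n%:Z %| k)%Z.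
Proof.
move=> eta_gt0 [a [b E]].
have ImE (x : int) z : complex.Im (x%:~R * z) = x%:~R * complex.Im z.
  by rewrite -(rmorph_int (real_complex R)) Im_realM.
have Imint (x : int) : complex.Im (x%:~R : R[i]) = 0.
  by rewrite -(rmorph_int (real_complex R)).
have := congr1 (@complex.Im R) E; rewrite raddfD /= Imint add0r !ImE.
have -> : n%:R * eta = n%:Z%:~R * eta by [].
rewrite ImE mulrA -intrM => /(mulIf (lt0r_neq0 eta_gt0))/intr_inj ->.
exact: dvdz_mull.
Qed.

(** For odd n, n tau is congruent to tau modulo the lattice. *)
Lemma not_lattice_odd eta tau (n : nat) : odd n -> has_order eta tau 2 ->
  ~ lattice eta (n%:R * tau).
Proof.
move=> n_odd [_ tau2 tau1]; rewrite mulr_natl -(odd_double_half n) n_odd mulrS.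
rewrite -mul2n mulrnA => L; apply: (tau1 1%N) => //.
rewrite mulr1n -[tau](addrK (tau *+ 2 *+ n./2)); apply: latticeD => //.
exact/latticeN/latticeMn.
Qed.

End Lattice.

Section ThetaAlpha.
Variable R : realType.
Variables (n : nat) (n_odd : odd n) (n_gt1 : (1 < n)%N).
Variables (eta : R[i]) (eta_gt0 : 0 < complex.Im eta).
Variables (tau : R[i]) (tau_order2 : has_order eta tau 2).
Implicit Types (z : R[i]) (a : int).
Local Notation e := (@e2pii R).
Local Notation etan := (n%:R * eta).
Local Notation vt := (theta etan).

Let n_gt0 : (0 < n)%N. Proof. exact: ltnW. Qed.
Let n_neq0 : n%:R != 0 :> R[i]. Proof. by rewrite pnatr_eq0 -lt0n. Qed.

Let etan_gt0 : 0 < complex.Im etan.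
Proof. by rewrite mulr_natl raddfMn /= pmulrn_rgt0. Qed.

Definition theta_exponent a z : R[i] :=
  a%:~R * z + (a * (a - n%:Z))%:~R / (2 * n)%:R * eta + a%:~R / (2 * n)%:R.

Lemma vt_tau_neq0 a : vt (n%:R * tau + a%:~R * eta) != 0.
Proof.
apply: theta_neq0 => // /lattice_muln L.
apply: (not_lattice_odd n_odd tau_order2).
rewrite -[_ * tau](addrK (a%:~R * eta)); apply: latticeD => //.
exact/latticeN/lattice_eta.
Qed.

Lemma theta_E : exists2 k : R[i], k != 0 & forall a z,
  theta_ n eta a z = k * (e (theta_exponent a z) * vt (n%:R * z + a%:~R * eta)).
Proof.
have vt0 : vt (n%:R * tau) != 0.
  by have := vt_tau_neq0 0; rewrite mul0r addr0.
(* The isogeny formula is used with base point tau, where neither side vanishes. *)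
exists ((\prod_(m < n) theta eta (tau + m%:R / n%:R)) / vt (n%:R * tau)).
  rewrite mulf_neq0 ?invr_neq0 //; apply/prodf_neq0 => m _.
  apply: theta_neq0 => // L; apply: (not_lattice_odd n_odd tau_order2).
  have L' := latticeMn n L; rewrite -[_ *+ n](mulr_natl (tau + _)) in L'.
  have E : n%:R * (tau + m%:R / n%:R) = n%:R * tau + m%:R by field.
  rewrite E in L'.
  rewrite -[_ * tau](addrK m%:R); apply: latticeD => //; apply: latticeN.
  by exists m%:Z, 0; rewrite mul0r addr0.
move=> a z; rewrite /theta_ -/(theta_exponent a z) mulrCA; congr (_ * _).
have := theta_isogeny (z + a%:~R / n%:R * eta) tau eta_gt0 n_gt0.
under eq_bigr do rewrite addrAC.
have -> : n%:R * (z + a%:~R / n%:R * eta) = n%:R * z + a%:~R * eta by field.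
by move=> E; apply: (mulIf vt0); rewrite E mulrAC divfK // mulrC.
Qed.

(** Raising the index by n shifts the argument Y of [vt] by its period n eta, with factor -e(-Y),
    and adds Y + 1/2 to the exponent; the two cancel. *)
Lemma theta_periodic a z (k : int) : theta_ n eta (a + k * n%:Z) z = theta_ n eta a z.
Proof.
have [c c0 tE] := theta_E.
have step b : theta_ n eta (b + n%:Z) z = theta_ n eta b z.
  rewrite !tE; congr (_ * _).
  have -> : n%:R * z + (b + n%:Z)%:~R * eta = n%:R * z + b%:~R * eta + etan.
    by rewrite intrD -[n%:Z%:~R]/(n%:R); ring.
  set Y := n%:R * z + b%:~R * eta.
  have -> : theta_exponent (b + n%:Z) z = theta_exponent b z + (Y + 1 / 2).
    rewrite /theta_exponent /Y !(intrM, intrD, intrN) natrM.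
    by rewrite -[n%:Z%:~R]/(n%:R); field.
  rewrite thetaDeta // e2piiD (e2piiD Y) e2pii_half e2piiN.
  by field; exact: e2pii_neq0.
have stepn m b : theta_ n eta (b + m%:Z * n%:Z) z = theta_ n eta b z.
  elim: m => [|m IHm]; first by rewrite mul0r addr0.
  have -> : b + m.+1%:Z * n%:Z = b + m%:Z * n%:Z + n%:Z by rewrite intS; ring.
  by rewrite step IHm.
case: k => m; first exact: stepn.
by rewrite NegzE mulNr -(stepn m.+1 (a - _)) subrK.
Qed.

Lemma theta_neq0_tau a : theta_ n eta a tau != 0.
Proof.
have [c c0 ->] := theta_E; apply: mulf_neq0 => //.
by apply: mulf_neq0; [exact: e2pii_neq0|exact: vt_tau_neq0].
Qed.

Lemma theta_neq0_0 a : ~~ (n%:Z %| a)%Z -> theta_ n eta a 0 != 0.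
Proof.
have [c c0 ->] := theta_E => na; apply: mulf_neq0 => //.
apply: mulf_neq0; first exact: e2pii_neq0.
apply: theta_neq0 => //; rewrite mulr0 add0r => /lattice_int_eta L.
by move/negP: na; apply; exact: L.
Qed.

(** The factor may depend on z but not on the index. In this form the property passes to sums and
    opposites, so only w = 1 and w = eta have to be computed. *)
Let shift_invariant (w : R[i]) := forall z, exists2 k : R[i], k != 0 &
  forall a, theta_ n eta a (z + w) = k * theta_ n eta a z.

Let shift_add w w' : shift_invariant w -> shift_invariant w' -> shift_invariant (w + w').
Proof.
move=> iw iw' z; have [k k0 kE] := iw z; have [k' k'0 kE'] := iw' (z + w).
exists (k' * k); first exact: mulf_neq0.
by move=> a; rewrite addrA kE' kE mulrA.
Qed.

Let shift_opp w : shift_invariant w -> shift_invariant (- w).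
Proof.
move=> iw z; have [k k0 kE] := iw (z - w).
exists k^-1; first exact: invr_neq0.
by move=> a; rewrite -{2}(subrK w z) kE mulKf.
Qed.

Let shift_int w (k : int) : shift_invariant w -> shift_invariant (k%:~R * w).
Proof.
move=> iw; have iwn m : shift_invariant (m%:R * w).
  elim: m => [|m IHm]; last by rewrite -natr1 mulrDl mul1r; exact: shift_add.
  by rewrite mul0r => z; exists 1; rewrite ?oner_neq0 // => a; rewrite addr0 mul1r.
case: k => m; first exact: iwn.
by rewrite NegzE mulrNz mulNr; apply: shift_opp; exact: iwn.
Qed.

Let shift1 : shift_invariant 1.
Proof.
have [c c0 tE] := theta_E => z; exists 1; rewrite ?oner_neq0 // => a.
rewrite mul1r !tE; congr (_ * (_ * _)).
  have -> : theta_exponent a (z + 1) = theta_exponent a z + a%:~R.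
    by rewrite /theta_exponent; ring.
  by rewrite e2piiD e2pii_int mulr1.
have vtn m y : vt (y + m%:R) = vt y.
  elim: m => [|m IHm]; first by rewrite addr0.
  by rewrite -natr1 addrA thetaD1.
by rewrite mulrDr mulr1 addrAC vtn.
Qed.

Let shift_eta : shift_invariant eta.
Proof.
have [c c0 tE] := theta_E => z; exists (- e (- (n%:R * z))).
  by rewrite oppr_eq0 e2pii_neq0.
move=> a; rewrite !tE [RHS]mulrCA; congr (_ * _).
have -> : n%:R * (z + eta) + a%:~R * eta = n%:R * z + a%:~R * eta + etan by ring.
have -> : theta_exponent a (z + eta) = theta_exponent a z + a%:~R * eta.
  by rewrite /theta_exponent; ring.
rewrite thetaDeta // e2piiD !e2piiN (e2piiD (n%:R * z)).
by field; rewrite !e2pii_neq0.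
Qed.

Lemma theta_lattice w : lattice eta w -> shift_invariant w.
Proof.
move=> [k [l ->]]; apply: shift_add; last exact: shift_int.
by rewrite -[k%:~R]mulr1; exact: shift_int.
Qed.

Lemma theta_opp_tau : exists2 k : R[i], k != 0 &
  forall a, theta_ n eta a (- tau) = k * theta_ n eta a tau.
Proof.
have [_ L _] := tau_order2; have [k k0 kE] := theta_lattice (latticeN L) tau.
by exists k => // a; rewrite -kE mulr2n opprD addrA subrr add0r.
Qed.

(** Parity of [vt] relates index -a at tau to index a at -tau. The exponent of the remaining factor
    is linear in a, so that in a product over e + d and e - d it no longer depends on d. *)
Lemma theta_opp_index : exists2 k : R[i], k != 0 &
  forall a, theta_ n eta (- a) tau = k * e (- (a%:~R / n%:R)) * theta_ n eta a tau.
Proof.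
have [k k0 kE] := theta_opp_tau; have [c c0 tE] := theta_E.
exists (- e (n%:R * tau) * k); first by rewrite mulf_neq0 // oppr_eq0 e2pii_neq0.
move=> a; have -> : - e (n%:R * tau) * k * e (- (a%:~R / n%:R)) * theta_ n eta a tau =
    - e (n%:R * tau) * e (- (a%:~R / n%:R)) * theta_ n eta a (- tau).
  by rewrite kE; ring.
rewrite !tE [RHS]mulrCA; congr (_ * _).
have -> : n%:R * tau + (- a)%:~R * eta = - (n%:R * - tau + a%:~R * eta).
  by rewrite intrN; ring.
set Y := n%:R * - tau + a%:~R * eta.
have -> : theta_exponent (- a) tau =
    n%:R * tau + (- (a%:~R / n%:R) + (theta_exponent a (- tau) + Y)).
  rewrite /theta_exponent /Y !(intrM, intrD, intrN) natrM.
  by rewrite -[n%:Z%:~R]/(n%:R); field.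
rewrite thetaN // e2piiD (e2piiD (- (_ / _))) (e2piiD (theta_exponent _ _)) (e2piiN Y).
by field; exact: e2pii_neq0.
Qed.

(** The addition formula writes vt(z+w) vt(z-w) as a pairing of two-dimensional vectors, one
    depending on z and one on w; the minors factor by multiplicativity of 2 by 2 determinants. *)
Let addition : exists U V : R[i] -> R[i] -> R[i], forall a b x y : R[i],
  vt (a + x) * vt (a - x) * (vt (b + y) * vt (b - y))
  - vt (a + y) * vt (a - y) * (vt (b + x) * vt (b - x)) = U a b * V x y.
Proof.
pose P0 z := theta (2 * etan) (2 * z + 1 / 2).
pose Q0 z := theta (2 * etan) (2 * z + etan + 1 / 2).
pose P1 z := e z * theta (2 * etan) (2 * z + etan + 1 / 2).
pose Q1 z := e z * theta (2 * etan) (2 * z + 2 * etan + 1 / 2).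
have E z w : vt (z + w) * vt (z - w) = P0 z * Q0 w - P1 z * Q1 w.
  by rewrite theta_addition // e2piiD /P0 /Q0 /P1 /Q1; ring.
exists (fun z w : R[i] => - (P0 z * P1 w - P1 z * P0 w)),
  (fun x y : R[i] => Q0 x * Q1 y - Q0 y * Q1 x).
move=> z w x y.
transitivity ((P0 z * Q0 x - P1 z * Q1 x) * (P0 w * Q0 y - P1 w * Q1 y)
  - (P0 z * Q0 y - P1 z * Q1 y) * (P0 w * Q0 x - P1 w * Q1 x)); last by ring.
by congr (_ * _ - _ * _); exact: E.
Qed.

(* At [x = a], [y = b] the first product vanishes, which identifies the product
   of the two minors. *)
Let addition_neq0 : exists U V : R[i] -> R[i] -> R[i],
  (forall a b x y : R[i],
    vt (a + x) * vt (a - x) * (vt (b + y) * vt (b - y))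
    - vt (a + y) * vt (a - y) * (vt (b + x) * vt (b - x)) = U a b * V x y) /\
  (forall a b : R[i], ~ lattice etan (a + b) -> ~ lattice etan (a - b) ->
    U a b != 0 /\ V a b != 0).
Proof.
have [U [V UV]] := addition; exists U, V; split=> // a b ab anb.
have nz1 := theta_neq0 etan_gt0 ab; have nz2 := theta_neq0 etan_gt0 anb.
have nz3 : vt (b - a) != 0 by apply: theta_neq0 => // /latticeN; rewrite opprB.
have : U a b * V a b != 0.
  rewrite -UV subrr theta0 // mulr0 mul0r sub0r oppr_eq0 (addrC b a).
  by apply: mulf_neq0; apply: mulf_neq0.
by rewrite mulf_eq0 negb_or => /andP.
Qed.

Lemma theta_minor : exists u v : int -> int -> R[i],
  [/\ forall a a' b b',
        theta_ n eta (a + b) tau * theta_ n eta (a - b) tau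
          * (theta_ n eta (a' + b') tau * theta_ n eta (a' - b') tau)
        - theta_ n eta (a + b') tau * theta_ n eta (a - b') tau
          * (theta_ n eta (a' + b) tau * theta_ n eta (a' - b) tau) = u a a' * v b b',
      forall a a', ~~ (n%:Z %| a + a')%Z -> ~~ (n%:Z %| a - a')%Z -> u a a' != 0
    & forall b b', ~~ (n%:Z %| b + b')%Z -> ~~ (n%:Z %| b - b')%Z -> v b b' != 0].
Proof.
have [c c0 tE] := theta_E; have [U [V [UV UV0]]] := addition_neq0.
(* The exponents of indices a + b and a - b add up to a part in a and a part in b, so they only
   scale rows and columns. *)
pose r (a : int) := e (2 * a%:~R * tau + (a * (a - n%:Z))%:~R / n%:R * eta + a%:~R / n%:R).
pose s (b : int) := e ((b * b)%:~R / n%:R * eta).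
pose al (a : int) := n%:R * tau + a%:~R * eta.
pose xi (b : int) := b%:~R * eta.
have LE a b : theta_ n eta (a + b) tau * theta_ n eta (a - b) tau =
    c ^+ 2 * r a * s b * (vt (al a + xi b) * vt (al a - xi b)).
  rewrite !tE /al /xi.
  have -> : n%:R * tau + (a + b)%:~R * eta = n%:R * tau + a%:~R * eta + b%:~R * eta.
    by rewrite intrD; ring.
  have -> : n%:R * tau + (a - b)%:~R * eta = n%:R * tau + a%:~R * eta - b%:~R * eta.
    by rewrite intrB; ring.
  have rs : r a * s b = e (theta_exponent (a + b) tau) * e (theta_exponent (a - b) tau).
    rewrite /r /s -!e2piiD; congr e.
    by rewrite /theta_exponent !(intrM, intrD, intrN) natrM -[n%:Z%:~R]/(n%:R); field.
  by rewrite -[_ * r a * s b]mulrA rs; ring.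
exists (fun a a' => c ^+ 4 * r a * r a' * U (al a) (al a')),
  (fun b b' => s b * s b' * V (xi b) (xi b')); split.
- move=> a a' b b'; rewrite !LE.
  transitivity (c ^+ 4 * r a * r a' * (s b * s b') * (U (al a) (al a') * V (xi b) (xi b'))).
    by rewrite -UV; ring.
  by ring.
- move=> a a' p1 p2; apply: mulf_neq0.
    by apply: mulf_neq0; [apply: mulf_neq0; [exact: expf_neq0|]|]; exact: e2pii_neq0.
  (* Here n (2 tau) = k n + l (n eta) lies even in the lattice of n eta, so modulo it [al a + al a']
     is (a + a') eta. *)
  have [_ [k [l E2]] _] := tau_order2.
  have al_add : al a + al a' = (k * n%:Z)%:~R + l%:~R * etan + (a + a')%:~R * eta.
    rewrite /al; have -> : n%:R * tau + a%:~R * eta + (n%:R * tau + a'%:~R * eta) =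
      n%:R * (tau *+ 2) + (a + a')%:~R * eta by rewrite intrD mulr2n; ring.
    by rewrite E2 intrM -[n%:Z%:~R]/(n%:R); ring.
  have al_sub : al a - al a' = (a - a')%:~R * eta by rewrite /al intrB; ring.
  have [] // := UV0 (al a) (al a').
    rewrite al_add => L; move/negP: p1; apply; apply: (lattice_int_eta eta_gt0).
    have := latticeD L (latticeN (_ : lattice etan ((k * n%:Z)%:~R + l%:~R * etan))).
    by rewrite addrAC subrr add0r; apply; exists (k * n%:Z), l.
  rewrite al_sub => L; move/negP: p2; apply; exact: (lattice_int_eta eta_gt0).
- move=> b b' p1 p2; apply: mulf_neq0.
    by apply: mulf_neq0; exact: e2pii_neq0.
  have [] // := UV0 (xi b) (xi b').
    rewrite /xi -mulrDl -intrD => L; move/negP: p1; apply.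
    exact: (lattice_int_eta eta_gt0).
  rewrite /xi -mulrBl -intrB => L; move/negP: p2; apply.
  exact: (lattice_int_eta eta_gt0).
Qed.

End ThetaAlpha.

Lemma dvdz_sub_eq (m x y : int) : (m %| x - y)%Z -> (m %| x)%Z = (m %| y)%Z.
Proof. by move=> H; rewrite -[x](subrK y) (rpredDl _ H). Qed.

(** * Passage to indices modulo p *)

Section ThetaMod.
Variable R : realType.
Variables (p : nat) (p_odd : odd p) (p_gt1 : (1 < p)%N).
Variables (eta : R[i]) (eta_gt0 : 0 < complex.Im eta).
Variables (tau : R[i]) (tau_order2 : has_order eta tau 2).
Local Notation th := (@theta_mod R p eta).

Lemma dvdz_val_add (a b : 'Z_p) : (p%:Z %| (val a)%:Z + (val b)%:Z - (val (a + b)%R)%:Z)%Z.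
Proof.
have -> : val (a + b) = ((val a + val b) %% p)%N.
  by rewrite /=; congr (_ %% _)%N; exact: Zp_cast.
apply/dvdzP; exists ((val a + val b) %/ p)%N%:Z.
by have := divn_eq (val a + val b) p; lia.
Qed.

Lemma dvdz_val_subE (a b : 'Z_p) :
  (p%:Z %| (val a)%:Z - (val b)%:Z - (val (a - b)%R)%:Z)%Z.
Proof.
have := dvdz_val_add (a - b) b; rewrite subrK -rpredN.
by move=> H; apply: etrans H; congr (_ %| _)%Z; ring.
Qed.

Lemma dvdz_val_opp (a : 'Z_p) : (p%:Z %| (val a)%:Z + (val (- a)%R)%:Z)%Z.
Proof. by have := dvdz_val_add a (- a); rewrite subrr subr0. Qed.

Lemma dvdz_val_eq0 (a : 'Z_p) : (p%:Z %| (val a)%:Z)%Z = (a == 0).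
Proof.
apply/idP/eqP => [|->]; last exact: dvdz0.
rewrite dvdzE /= => pa; apply/val_inj => /=; have [//|a_gt0] := posnP a.
by have := dvdn_leq a_gt0 pa; rewrite leqNgt (ltn_Zp p_gt1).
Qed.

Lemma dvdz_val_sub (a b : 'Z_p) : (p%:Z %| (val a)%:Z - (val b)%:Z)%Z = (a == b).
Proof.
rewrite -subr_eq0 -dvdz_val_eq0; apply: dvdz_sub_eq.
have := dvdz_val_add (a - b) b; rewrite subrK -rpredN => H; apply: etrans H; congr (_ %| _)%Z; ring.
Qed.

Lemma dvdz_val_addN (a b : 'Z_p) : (p%:Z %| (val a)%:Z + (val b)%:Z)%Z = (a == - b).
Proof.
rewrite -dvdz_val_sub; apply: dvdz_sub_eq.
by have := dvdz_val_opp b => H; apply: etrans H; congr (_ %| _)%Z; ring.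
Qed.

Lemma theta_mod_int (a : 'Z_p) (k : int) z :
  (p%:Z %| k - (val a)%:Z)%Z -> th a z = theta_ p eta k z.
Proof.
move=> /dvdzP[m /eqP]; rewrite subr_eq => /eqP ->.
by rewrite addrC; symmetry; exact: (theta_periodic p_odd p_gt1 eta_gt0 tau_order2).
Qed.

Lemma theta_modD (a b : 'Z_p) z :
  th (a + b) z = theta_ p eta ((val a)%:Z + (val b)%:Z) z.
Proof. exact: theta_mod_int (dvdz_val_add a b). Qed.

Lemma theta_modB (a b : 'Z_p) z :
  th (a - b) z = theta_ p eta ((val a)%:Z - (val b)%:Z) z.
Proof. exact: theta_mod_int (dvdz_val_subE a b). Qed.

Lemma theta_modN (a : 'Z_p) (k : int) z :
  (p%:Z %| k - (val a)%:Z)%Z -> th (- a) z = theta_ p eta (- k) z.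
Proof.
move=> ka; apply: theta_mod_int; rewrite -(dvdz_sub_eq (x := - (k - (val a)%:Z))).
  by rewrite rpredN.
by have := dvdz_val_opp a => H; apply: etrans H; congr (_ %| _)%Z; ring.
Qed.

Lemma theta_mod_opp : exists2 k : R[i], k != 0 & forall e d : 'Z_p,
  th (- e + d) tau * th (- e - d) tau =
    k * e2pii (- (2 * (val e)%:R / p%:R)) * (th (e + d) tau * th (e - d) tau).
Proof.
have [k k0 kE] := theta_opp_index p_odd p_gt1 eta_gt0 tau_order2.
exists (k ^+ 2); first exact: expf_neq0.
move=> e d; have -> : - e + d = - (e - d) by rewrite opprB addrC.
have -> : - e - d = - (e + d) by rewrite opprD.
rewrite (theta_modN _ (dvdz_val_subE e d)) (theta_modN _ (dvdz_val_add e d)) !kE.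
rewrite theta_modB theta_modD.
have -> : - (2 * (val e)%:R / p%:R) = - (((val e)%:Z - (val d)%:Z)%:~R / p%:R)
   - (((val e)%:Z + (val d)%:Z)%:~R / p%:R) :> R[i].
  rewrite !intrD intrN -[(val e)%:Z%:~R]/((val e)%:R); ring.
rewrite e2piiD; ring.
Qed.

Local Notation L := (fun e d : 'Z_p => th (e + d) tau * th (e - d) tau).

Lemma theta_mod_minor : exists u v : 'Z_p -> 'Z_p -> R[i],
  [/\ forall e e' d d', L e d * L e' d' - L e d' * L e' d = u e e' * v d d',
      forall e e', e != e' -> e != - e' -> u e e' != 0
    & forall d d', d != d' -> d != - d' -> v d d' != 0].
Proof.
have [u [v [uvE u0 v0]]] := theta_minor p_odd p_gt1 eta_gt0 tau_order2.
exists (fun e e' => u (val e)%:Z (val e')%:Z), (fun d d' => v (val d)%:Z (val d')%:Z).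
split=> [e e' d d'|e e' ee eeN|d d' dd ddN].
- by rewrite -uvE !theta_modB !theta_modD.
- by apply: u0; rewrite ?dvdz_val_addN ?dvdz_val_sub.
- by apply: v0; rewrite ?dvdz_val_addN ?dvdz_val_sub.
Qed.

End ThetaMod.

Theorem theorem1p2 (R : realType) (p : nat) (p_prime : prime p) (p_odd : odd p)
    (eta : complex R) (eta_upper : (0 < complex.Im eta)%R)
    (tau : complex R) (tau_order2 : has_order eta tau 2) :
  is_graded_clifford (sklyanin p eta tau).
Proof.
have p_gt1 := prime_gt1 p_prime.
pose t (a : 'Z_p) := theta_mod eta a tau.
pose t' (a : 'Z_p) := theta_mod eta a (- tau).
pose w (a : 'Z_p) := theta_mod eta a 0.
have t_neq0 a : t a != 0 by exact: (theta_neq0_tau p_odd p_gt1 eta_upper tau_order2).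
have w_neq0 a : a != 0 -> w a != 0.
  by move=> a0; apply: (theta_neq0_0 p_odd p_gt1 eta_upper tau_order2); rewrite dvdz_val_eq0.
have t'E : exists2 k, k != 0 & forall a, t' a = k * t a.
  have [k k0 kE] := theta_opp_tau p_odd p_gt1 eta_upper tau_order2.
  by exists k => // a; exact: kE.
have [k k0 kE] := theta_mod_opp p_odd p_gt1 eta_upper tau_order2.
have [u [v [uv u0 v0]]] := theta_mod_minor p_odd p_gt1 eta_upper tau_order2.
have L_neq0 e d : t (e + d) * t (e - d) != 0 by rewrite mulf_neq0.
have L_even e d : t (e + - d) * t (e - - d) = t (e + d) * t (e - d).
  by rewrite opprK mulrC.
have L_opp e : exists2 r, r != 0 & forall d,
    t (- e + d) * t (- e - d) = r * (t (e + d) * t (e - d)).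
  exists (k * e2pii (- (2 * (val e)%:R / p%:R))); last by move=> d; exact: kE.
  by apply: mulf_neq0 => //; exact: e2pii_neq0.
have [c [cN c0 c_sum c_inv]] := rank_two_inverse p_gt1 p_odd L_neq0 L_even L_opp uv u0 v0.
have z_prim : p.-primitive_root (e2pii (1 / p%:R) : R[i]).
  by apply: e2pii_prim; [exact: ltnW|rewrite expr1n].
exact: (theta_algebra_graded_clifford p_gt1 p_odd t_neq0 w_neq0 t'E cN c0 c_sum z_prim c_inv).
Qed.
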